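(* Let $p\ge 0$ and $m\ge 0$ be integers and let $z$ be a real number with $0<|z|<1$. Then $$\sum_{n=0}^{\infty} \frac{\zeta(2n)z^{2n}}{(2n+1)\cdots(2n+m+1)(2n+m+p+2)} = (p+m+2)\bigg((-1)^{m+1}p!\sum_{k=m+3}^{p+m+3}\frac{\pi z\,(-1)^{\lfloor \frac{k}{2} \rfloor}\,\mathrm{Cl}_{k}(2\pi z)}{(p+m+3-k)!\,(2\pi z)^k}-\delta_{\lfloor \frac{p+m}{2} \rfloor, \frac{p+m}{2}}\frac{p!\,(-1)^{\frac{p+m}{2}}(-1)^m\,\zeta(p+m+3)}{2(2\pi z)^{m+p+2}}\bigg)$$ $$\qquad+\frac{(-1)^{\lfloor \frac{m+1}{2} \rfloor}\,\mathrm{Cl}_{m+2}(2\pi z)}{2(2\pi z)^{m+1}}+\sum_{k=1}^{\lfloor \frac{m+1}{2} \rfloor} \frac{k(-1)^k\,\zeta(2k+1)}{(2\pi z)^{2k}\,(m+1-2k)!\,(m+p+2-2k)}.$$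
   Context: The denominator on the left is $\prod_{i=1}^{m+1}(2n+i)\cdot(2n+m+p+2)$. The generalized Clausen functions of a real variable $\theta$ are $\mathrm{Cl}_{2j}(\theta)=\sum_{k=1}^\infty \frac{\sin(k\theta)}{k^{2j}}$ for $j\ge1$ and $\mathrm{Cl}_{2j+1}(\theta)=\sum_{k=1}^\infty \frac{\cos(k\theta)}{k^{2j+1}}$ for $j\ge0$. $\zeta$ is the Riemann zeta function, with $\zeta(0)=-\tfrac12$. $\delta_{a,b}$ is the Kronecker delta, so $\delta_{\lfloor n/2\rfloor,n/2}$ is $1$ if $n$ is even and $0$ if $n$ is odd; a term multiplied by it is read as $0$ when $n$ is odd. Empty sums are $0$. *)

(* Defs.v *)
From Stdlib Require Import Reals Arith.
From Coquelicot Require Import Coquelicot.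
Local Open Scope R_scope.

(* The Riemann zeta function at nonnegative integers other than its pole 1:
   zeta 0 is the value of the analytic continuation, and zeta s for s >= 2 is
   the Dirichlet series.  zeta 1 is a meaningless default value. *)
Definition zeta (s : nat) : R :=
  match s with
  | O => - (1 / 2)
  | _ => Series (fun n => / INR (S n) ^ s)
  end.

(* The sums start at 1 in the usual notation, hence the shift n |-> S n.
   The series converge for every theta if k >= 2, and also for k = 1 if theta
   is not a multiple of 2 PI; Cl 0 is a meaningless default value. *)
Definition Cl (k : nat) (theta : R) : R :=
  if Nat.even k
  then Series (fun n => sin (INR (S n) * theta) / INR (S n) ^ k)
  else Series (fun n => cos (INR (S n) * theta) / INR (S n) ^ k).

(* Kronecker delta on real arguments, since n / 2 need not be an integer. *)
Definition kronecker (a b : R) : R := if Req_dec_T a b then 1 else 0.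

(* (2n + 1) (2n + 2) ... (2n + m + 1); prod_f_R0 f m = f 0 * ... * f m. *)
Definition consecutive_prod (n m : nat) : R :=
  prod_f_R0 (fun i => INR (2 * n + S i)) m.

(* Main.v *)
Require Import Defs.
From Stdlib Require Import Reals Arith Ranalysis5 Lra Lia.
From Coquelicot Require Import Coquelicot.
Local Open Scope R_scope.

(** Multiplied by [z^(m+p+2)], both sides are antiderivatives of the same
    function of [z], obtained from one functional identity by repeated
    integration from 0.

    The identity is [sum zeta(2n) z^(2n) = - (PI z / 2) cot (PI z)]
    ([is_series_zeta_even]).  It comes from the product formula for the sine:
    integration by parts relates the integrals of [cos (2 z x) cos^(2n) x] on
    [[0, PI/2]] for consecutive [n], which gives the finite product with a
    remainder tending to 1; logarithmic differentiation and geometric series do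
    the rest.

    On the other side, let [D_k] be [Cl_k (2 PI z) / (2 PI)^k] up to a sign
    chosen so that [D_(k+1)' = D_k] ([clausen_tower], [is_derive_tower]).  The
    tower goes down to [D_1 = ln (2 sin (PI z)) / (2 PI)] and
    [D_0 = cot (PI z) / 2]; the step from [D_2] to [D_1] is the Fourier series
    of the logarithm of the sine ([is_derive_Cl_2]), which converges only
    conditionally and needs a quantitative bound on its partial sums.

    The zeta series is thus [- PI z D_0].  Since
    [(- z D_(j+1) + (j+1) D_(j+2))' = - z D_j + j D_(j+1)], its [j]-fold
    primitive vanishing at 0 is [PI (- z D_j + j D_(j+1))] plus a polynomial
    that accounts for the constants of integration; these come from the
    values [D_(2i+1) 0], which are multiples of [zeta (2i+1)] ([zeta_primitive_eq]).  Taking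
    [j = m + 1] produces the denominators [(2n+1) ... (2n+m+1)].  Multiplying by
    [z^p] and integrating once more produces the factor [2n+m+p+2]
    ([weighted_series_eq]); on the Clausen side, repeated integration by parts
    gives the sum over [k] and, at the endpoint 0, the Kronecker term
    ([moment_expand]).  Negative [z] follows because both sides are even. *)

(** The algebraic structures on [R] leave equations typed in one of their
    carriers, which [ring] and [field] do not recognize as [R]. *)
Ltac real_eq := match goal with |- @eq _ ?a ?b => change (@eq R a b) end.

(** * Termwise continuity and differentiation of dominated series *)

(** Weierstrass M-test: the remainder after [N] terms is bounded by the
    remainder of the dominating series, which does not depend on [y]. *)
Lemma CVU_Series_dominated (f : nat -> R -> R) (M : nat -> R) (c : R) (r : posreal) :
  ex_series M ->
  (forall n y, Boule c r y -> Rabs (f n y) <= M n) ->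
  CVU (fun N y => sum_n (fun n => f n y) N) (fun y => Series (fun n => f n y)) c r.
Proof.
intros HM Hf eps Heps.
destruct HM as [l Hl].
assert (Hl' := Hl).
change (is_lim_seq (sum_n M) l) in Hl; apply is_lim_seq_spec in Hl.
destruct (Hl (mkposreal eps Heps)) as [N HN]; simpl in HN.
exists N; intros n y Hn Hy.
assert (HMe : ex_series M) by (exists l; exact Hl').
assert (Ha : ex_series (fun k => Rabs (f k y))).
{ apply (ex_series_le (K := R_AbsRing) (V := R_CompleteNormedModule) _ M).
  2: exact HMe.
  intros k; unfold norm; simpl; unfold abs; simpl; rewrite Rabs_Rabsolu; now apply Hf. }
assert (Hs := ex_series_Rabs _ Ha).
rewrite (Series_incr_n (fun k => f k y) (S n)); try easy; try lia.
simpl pred.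
rewrite <- sum_n_Reals.
replace (_ + _ - _) with (Series (fun k => f (S n + k)%nat y)) by ring.
apply Rle_lt_trans with (Series (fun k => M (S n + k)%nat)).
- eapply Rle_trans.
  + apply Series_Rabs. exact (proj1 (ex_series_incr_n (fun k => Rabs (f k y)) (S n)) Ha).
  + apply Series_le.
    * intros k; split; [apply Rabs_pos | now apply Hf].
    * exact (proj1 (ex_series_incr_n M (S n)) HMe).
- assert (E := Series_incr_n M (S n) ltac:(lia) HMe).
  simpl pred in E. rewrite <- sum_n_Reals in E.
  rewrite (is_series_unique _ _ Hl') in E.
  specialize (HN n Hn).
  assert (H := Rle_abs (-(sum_n M n - l))). rewrite Rabs_Ropp in H. lra.
Qed.

Lemma is_lim_seq_Series_pointwise (a : nat -> R) :
  ex_series a -> Un_cv (fun N => sum_n a N) (Series a).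
Proof.
intros H. apply is_lim_seq_Reals. now apply Series_correct.
Qed.

Lemma continuity_pt_sum_n (f : nat -> R -> R) (N : nat) (y : R) :
  (forall n, continuity_pt (f n) y) ->
  continuity_pt (fun y => sum_n (fun n => f n y) N) y.
Proof.
intros H; induction N.
- apply continuity_pt_ext with (f O); [intros; now rewrite sum_O | apply H].
- apply continuity_pt_ext with (fun y => sum_n (fun n => f n y) N + f (S N) y).
  + intros; now rewrite sum_Sn.
  + apply (continuity_pt_plus _ _ y IHN (H (S N))).
Qed.

Lemma continuity_pt_Series_dominated (f : nat -> R -> R) (M : nat -> R) (c : R) (r : posreal) :
  ex_series M ->
  (forall n y, Boule c r y -> Rabs (f n y) <= M n) ->
  (forall n y, Boule c r y -> continuity_pt (f n) y) ->
  forall y, Boule c r y -> continuity_pt (fun y => Series (fun n => f n y)) y.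
Proof.
intros HM Hf Hc y Hy.
apply CVU_continuity with (x := c) (r := r) (fn := fun N y => sum_n (fun n => f n y) N); auto.
- now apply CVU_Series_dominated with M.
- intros n x Hx; apply continuity_pt_sum_n; intros k; now apply Hc.
Qed.

(** Only the series of derivatives has to be dominated; for the series itself
    pointwise convergence is enough. *)
Lemma is_derive_Series_dominated (f f' : nat -> R -> R) (M : nat -> R) (x : R) (r : posreal) :
  ex_series M ->
  (forall n y, Boule x r y -> is_derive (f n) y (f' n y)) ->
  (forall n y, Boule x r y -> continuity_pt (f' n) y) ->
  (forall n y, Boule x r y -> Rabs (f' n y) <= M n) ->
  (forall y, Boule x r y -> ex_series (fun n => f n y)) ->
  is_derive (fun y => Series (fun n => f n y)) x (Series (fun n => f' n x)).
Proof.
intros HM Hd Hc Hb Hf.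
apply is_derive_Reals.
apply (derivable_pt_lim_CVU (fun N y => sum_n (fun n => f n y) N)
  (fun N y => sum_n (fun n => f' n y) N) _ (fun y => Series (fun n => f' n y)) x x r).
- unfold Boule; rewrite Rminus_diag, Rabs_R0; apply cond_pos.
- intros y N Hy; apply is_derive_Reals.
  apply (is_derive_sum_n (K := R_AbsRing) (V := R_NormedModule)); intros k _; now apply Hd.
- intros y Hy; apply is_lim_seq_Series_pointwise; now apply Hf.
- now apply CVU_Series_dominated with M.
- now apply continuity_pt_Series_dominated with M.
Qed.

Lemma INR_S_pos (n : nat) : 0 < INR (S n).
Proof. apply lt_0_INR; lia. Qed.

(** Comparison with the telescoping series of [2 / ((n+1) (n+2))]. *)
Lemma ex_series_inv_pow (k : nat) : (2 <= k)%nat -> ex_series (fun n => / INR (S n) ^ k).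
Proof.
intros Hk.
apply (ex_series_le (K := R_AbsRing) (V := R_CompleteNormedModule) _
  (fun n => 2 * (/ INR (S n) - / INR (S (S n))))).
- intros n; change (norm (/ INR (S n) ^ k)) with (Rabs (/ INR (S n) ^ k)).
  rewrite (S_INR (S n)).
  assert (H2 : 1 <= INR (S n)) by (change 1 with (INR 1); apply le_INR; lia).
  set (a := INR (S n)) in *; clearbody a.
  rewrite Rabs_pos_eq by (left; apply Rinv_0_lt_compat, pow_lt; lra).
  apply Rle_trans with (/ a ^ 2).
  + apply Rinv_le_contravar; [apply pow_lt; lra | now apply Rle_pow].
  + replace (2 * _) with (/ (a * ((a + 1) / 2))) by (field; lra).
    apply Rinv_le_contravar; [apply Rmult_lt_0_compat; lra | nra].
- apply (ex_series_scal (K := R_AbsRing) (V := R_NormedModule) 2).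
  assert (L : is_lim_seq (fun n => 1 - / INR (S (S n))) 1).
  { replace 1 with (1 - 0) at 1 by ring.
    apply is_lim_seq_minus'; [apply is_lim_seq_const |].
    apply (is_lim_seq_incr_1 (fun n => / INR (S n))), (is_lim_seq_incr_1 (fun n => / INR n)).
    exact (is_lim_seq_inv _ _ is_lim_seq_INR ltac:(discriminate)). }
  exists 1; revert L; apply is_lim_seq_ext.
  intros n; induction n.
  + rewrite sum_O; change (INR 1) with 1; rewrite Rinv_1; ring.
  + rewrite sum_Sn, <- IHn; change plus with Rplus; cbv beta; ring.
Qed.

(** * The product formula for the sine *)

(** The ratio [cos_moment (2n) (2z) / cos_moment (2n) 0] is
    [sin (PI z) / (PI z)] for [n = 0] and tends to 1 as [n] tends to infinity. *)
Definition cos_moment (n : nat) (a : R) : R :=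
  RInt (fun x => cos (a * x) * cos x ^ n) 0 (PI / 2).

Lemma ex_RInt_cos_moment (n : nat) (a : R) :
  ex_RInt (fun x => cos (a * x) * cos x ^ n) 0 (PI / 2).
Proof.
apply (ex_RInt_continuous (V := R_CompleteNormedModule)); intros x _.
apply (ex_derive_continuous (V := R_NormedModule)).
auto_derive; trivial.
Qed.

(** Two integrations by parts, packaged as the fundamental theorem of calculus
    for an explicit function [F] that vanishes at both ends. *)
Lemma cos_moment_rec (n : nat) (a : R) :
  (INR (n + 2) ^ 2 - a ^ 2) * cos_moment (n + 2) a
  = INR (n + 2) * INR (n + 1) * cos_moment n a.
Proof.
pose (F := fun x => a * sin (a * x) * cos x ^ (n + 2)
                    - INR (n + 2) * cos (a * x) * cos x ^ (n + 1) * sin x).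
pose (F' := fun x => (a ^ 2 - INR (n + 2) ^ 2) * (cos (a * x) * cos x ^ (n + 2))
                    + INR (n + 2) * INR (n + 1) * (cos (a * x) * cos x ^ n)).
assert (HF : is_RInt F' 0 (PI / 2) (F (PI / 2) - F 0)).
{ apply (is_RInt_derive (V := R_CompleteNormedModule)); intros x _.
  - unfold F, F'. auto_derive; trivial.
    replace (n + 2)%nat with (S (S n)) by lia.
    replace (n + 1)%nat with (S n) by lia.
    rewrite !S_INR; simpl pred; simpl pow.
    assert (Hs := sin2_cos2 x). unfold Rsqr in Hs.
    replace (sin x * sin x) with (1 - cos x * cos x) by lra.
    transitivity (- (INR n + 1 + 1) * cos (a * x) *
       (- ((INR n + 1) * (cos x ^ n * (sin x * sin x))) + cos x * cos x ^ n * cos x) + a ^ 2 * cos (a * x) * (cos x * (cos x * cos x ^ n))).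
    + ring.
    + replace (sin x * sin x) with (1 - cos x * cos x) by lra. ring.
  - apply (ex_derive_continuous (V := R_NormedModule)). unfold F'. auto_derive; trivial. }
assert (HE : is_RInt F' 0 (PI / 2)
  ((a ^ 2 - INR (n + 2) ^ 2) * cos_moment (n + 2) a + INR (n + 2) * INR (n + 1) * cos_moment n a)).
{ apply (is_RInt_plus (V := R_NormedModule)); apply (is_RInt_scal (V := R_NormedModule));
    apply (RInt_correct (V := R_CompleteNormedModule)), ex_RInt_cos_moment. }
assert (E := eq_trans (eq_sym (is_RInt_unique _ _ _ _ HF)) (is_RInt_unique _ _ _ _ HE)).
unfold F in E; rewrite cos_PI2, !Rmult_0_r, !sin_0, !pow_i in E by lia.
lra.
Qed.

Lemma cos_moment_0_pos (n : nat) : 0 < cos_moment n 0.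
Proof.
apply RInt_gt_0.
- assert (H := PI_RGT_0); lra.
- intros x Hx. rewrite Rmult_0_l, cos_0, Rmult_1_l. apply pow_lt, cos_gt_0; lra.
- intros x Hx. apply (ex_derive_continuous (V := R_NormedModule)).
  auto_derive; trivial.
Qed.

Lemma x_cos_le_sin (x : R) : 0 <= x <= PI / 2 -> x * cos x <= sin x.
Proof.
intros Hx.
destruct (MVT_gen (fun x => sin x - x * cos x) 0 x (fun x => x * sin x)) as [c [Hc E]].
- intros y _; auto_derive; trivial; ring.
- intros y _; apply derivable_continuous_pt.
  apply ex_derive_Reals_0; auto_derive; trivial.
- rewrite Rmin_left, Rmax_right in Hc by lra.
  rewrite sin_0 in E.
  assert (0 <= c * sin c) by (apply Rmult_le_pos; [lra | apply sin_ge_0; lra]).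
  nra.
Qed.

Lemma one_minus_cos_le (y : R) : 0 <= 1 - cos y <= y ^ 2 / 2.
Proof.
assert (H := COS_bound y). split; [lra |].
replace y with (2 * (y / 2)) at 1 by field.
rewrite cos_2a_sin.
assert (Hs : Rabs (sin (y / 2)) <= Rabs (y / 2)).
{ destruct (MVT_gen sin 0 (y / 2) cos) as [c [_ E]].
  - intros; auto_derive; trivial; ring.
  - intros; apply continuity_sin.
  - rewrite sin_0, !Rminus_0_r in E. rewrite E, Rabs_mult.
    rewrite <- (Rmult_1_l (Rabs (y / 2))) at 2.
    apply Rmult_le_compat_r; [apply Rabs_pos |].
    apply Rabs_le; assert (Hc := COS_bound c); lra. }
apply Rsqr_le_abs_1 in Hs. unfold Rsqr in Hs. lra.
Qed.

(** The mass of [cos^(2m+2)] concentrates at 0: [1 - cos (a x)] is at most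
    [a^2 x^2 / 2], and [x cos x <= sin x] turns [x^2 cos^(2m+2) x] into
    [cos^(2m) x - cos^(2m+2) x], whose integral the recurrence evaluates. *)
Lemma cos_moment_near (m : nat) (a : R) :
  Rabs (cos_moment (2 * m + 2) a / cos_moment (2 * m + 2) 0 - 1) <= a ^ 2 / 2 / INR (2 * m + 1).
Proof.
assert (Hp := cos_moment_0_pos (2 * m + 2)).
assert (Hm : 0 < INR (2 * m + 1)) by (apply lt_0_INR; lia).
assert (HI : is_RInt (fun x => cos (0 * x) * cos x ^ (2 * m + 2) - cos (a * x) * cos x ^ (2 * m + 2))
   0 (PI / 2) (cos_moment (2 * m + 2) 0 - cos_moment (2 * m + 2) a)).
{ apply (is_RInt_minus (V := R_NormedModule));
  apply (RInt_correct (V := R_CompleteNormedModule)), ex_RInt_cos_moment. }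
assert (HB : is_RInt (fun x => a ^ 2 / 2 * (cos (0 * x) * cos x ^ (2 * m) - cos (0 * x) * cos x ^ (2 * m + 2)))
   0 (PI / 2) (a ^ 2 / 2 * (cos_moment (2 * m) 0 - cos_moment (2 * m + 2) 0))).
{ apply (is_RInt_scal (V := R_NormedModule)), (is_RInt_minus (V := R_NormedModule));
  apply (RInt_correct (V := R_CompleteNormedModule)), ex_RInt_cos_moment. }
assert (Hpi := PI_RGT_0).
assert (H0 : 0 <= cos_moment (2 * m + 2) 0 - cos_moment (2 * m + 2) a).
{ apply (is_RInt_le (fun _ => 0) _ 0 (PI / 2) 0 _ ltac:(lra)) with (2 := HI).
  - evar_last; [apply (is_RInt_const (V := R_NormedModule)) |].
    unfold scal; simpl; unfold mult; simpl; ring.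
  - intros x Hx. rewrite Rmult_0_l, cos_0, <- Rmult_minus_distr_r.
    apply Rmult_le_pos; [apply one_minus_cos_le | apply pow_le, cos_ge_0; lra]. }
assert (H1 := is_RInt_le _ _ 0 (PI / 2) _ _ ltac:(lra) HI HB).
assert (R := cos_moment_rec (2 * m) 0).
replace (2 * m + 2)%nat with (S (S (2 * m))) in * by lia.
replace (2 * m + 1)%nat with (S (2 * m)) in * by lia.
set (K := cos_moment (S (S (2 * m))) 0) in *.
set (L := cos_moment (S (S (2 * m))) a) in *.
assert (H2 : K - L <= a ^ 2 / 2 * (cos_moment (2 * m) 0 - K)).
{ apply H1; intros x Hx.
  rewrite Rmult_0_l, cos_0.
  assert (Hc : 0 <= cos x) by (apply cos_ge_0; lra).
  assert (Hcm : 0 <= cos x ^ (2 * m)) by now apply pow_le.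
  assert (Hsc := x_cos_le_sin x ltac:(lra)).
  assert (H3 := one_minus_cos_le (a * x)).
  assert (Hs2 := sin2_cos2 x); unfold Rsqr in Hs2.
  simpl pow.
  set (t := cos x ^ _) in *.
  apply Rle_trans with ((a * x) ^ 2 / 2 * (cos x * (cos x * t))).
  - replace (1 * _ - _) with ((1 - cos (a * x)) * (cos x * (cos x * t))) by ring.
    apply Rmult_le_compat_r; [| apply H3]. repeat apply Rmult_le_pos; trivial.
  - replace (a * (a * 1) / 2 * _) with (a ^ 2 / 2 * t * (1 - cos x * cos x)) by field.
    replace (_ / 2 * _) with (a ^ 2 / 2 * t * ((x * cos x) * (x * cos x))) by field.
    apply Rmult_le_compat_l.
    + apply Rmult_le_pos; trivial. assert (Hsq := pow2_ge_0 a); lra.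
    + assert (0 <= x * cos x) by (apply Rmult_le_pos; lra). nra. }
rewrite S_INR in R. set (q := INR (S (2 * m))) in *.
assert (E : cos_moment (2 * m) 0 - K = K / q).
{ apply Rmult_eq_reg_l with ((q + 1) * q); [| nra].
  rewrite Rmult_minus_distr_l, <- R; field; lra. }
rewrite E in H2.
replace (L / K - 1) with (- ((K - L) / K)) by (field; lra).
rewrite Rabs_Ropp, Rabs_pos_eq.
- apply Rmult_le_reg_r with K; trivial.
  replace ((K - L) / K * K) with (K - L) by (field; lra).
  replace (_ / q * K) with (a ^ 2 / 2 * (K / q)) by (field; lra). exact H2.
- apply Rmult_le_pos; trivial. left; now apply Rinv_0_lt_compat.
Qed.

(** Euler's product for the sine, stopped after [N + 1] factors, with its
    exact remainder. *)
Lemma sin_eq_partial_product (z : R) (N : nat) : z <> 0 ->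
  sin (PI * z) / (PI * z) =
  prod_f_R0 (fun k => 1 - z ^ 2 / INR (S k) ^ 2) N
  * (cos_moment (2 * N + 2) (2 * z) / cos_moment (2 * N + 2) 0).
Proof.
intros Hz.
assert (Hpi := PI_RGT_0).
assert (Hstep : forall n, cos_moment (2 * n) (2 * z) / cos_moment (2 * n) 0 =
  (1 - z ^ 2 / INR (S n) ^ 2) * (cos_moment (2 * n + 2) (2 * z) / cos_moment (2 * n + 2) 0)).
{ intros n.
  assert (R1 := cos_moment_rec (2 * n) (2 * z)).
  assert (R0 := cos_moment_rec (2 * n) 0).
  assert (P1 := cos_moment_0_pos (2 * n)).
  assert (P2 := cos_moment_0_pos (2 * n + 2)).
  assert (Q1 : 0 < INR (2 * n + 1)) by (apply lt_0_INR; lia).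
  assert (Q2 := INR_S_pos n).
  replace (INR (2 * n + 2)) with (2 * INR (S n)) in R1, R0
    by (rewrite S_INR, plus_INR, mult_INR; simpl; ring).
  set (A := cos_moment (2 * n) (2 * z)) in *. set (B := cos_moment (2 * n + 2) (2 * z)) in *.
  set (C := cos_moment (2 * n) 0) in *. set (D := cos_moment (2 * n + 2) 0) in *.
  set (q := INR (2 * n + 1)) in *. set (s := INR (S n)) in *.
  assert (EA : A = (4 * s ^ 2 - 4 * z ^ 2) * B / (2 * s * q)).
  { apply Rmult_eq_reg_l with (2 * s * q); [| nra]. rewrite <- R1; field; lra. }
  assert (EC : C = (4 * s ^ 2) * D / (2 * s * q)).
  { apply Rmult_eq_reg_l with (2 * s * q); [| nra]. rewrite <- R0; field; lra. }
  rewrite EA, EC. field. repeat split; lra. }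
induction N.
- cbn [prod_f_R0]. change (2 * 0 + 2)%nat with 2%nat.
  assert (E := Hstep O); change (2 * 0 + 2)%nat with 2%nat in E. rewrite <- E.
  assert (EJ : forall a, a <> 0 -> cos_moment 0 a = sin (a * (PI / 2)) / a).
  { intros a Ha. unfold cos_moment.
    rewrite (RInt_ext _ (fun x => cos (a * x))) by (intros; simpl; ring).
    apply is_RInt_unique. evar_last.
    - apply (is_RInt_derive (V := R_CompleteNormedModule) (fun x => sin (a * x) / a)).
      + intros x _; auto_derive; trivial. field; trivial.
      + intros x _; apply (ex_derive_continuous (V := R_NormedModule)); auto_derive; trivial.
    - unfold minus, plus, opp; simpl. rewrite Rmult_0_r, sin_0. field; trivial. }
  simpl (2 * 0)%nat. rewrite EJ by lra.
  replace (cos_moment 0 0) with (PI / 2).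
  + replace (2 * z * (PI / 2)) with (PI * z) by field. field. lra.
  + unfold cos_moment. rewrite (RInt_ext _ (fun _ => 1)) by (intros; simpl; rewrite Rmult_0_l, cos_0; ring).
    rewrite RInt_const. unfold scal; simpl; unfold mult; simpl; ring.
- rewrite IHN. cbn [prod_f_R0].
  replace (2 * N + 2)%nat with (2 * S N)%nat by lia.
  rewrite (Hstep (S N)). ring.
Qed.

(** * The generating function of the even zeta values *)

Lemma is_lim_seq_le_const_0 (u v : nat -> R) (l : R) :
  (forall n, Rabs (u n - l) <= v n) -> is_lim_seq v 0 -> is_lim_seq u l.
Proof.
intros H Hv.
apply is_lim_seq_ext with (fun n => (u n - l) + l); [intros; ring |].
replace (Finite l) with (Finite (0 + l)) by (f_equal; ring).
apply is_lim_seq_plus'; [| apply is_lim_seq_const].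
apply is_lim_seq_abs_0.
apply is_lim_seq_le_le with (fun _ => 0) v; trivial.
- intros n; split; [apply Rabs_pos | apply H].
- apply is_lim_seq_const.
Qed.

Lemma is_lim_seq_div_linear (C : R) : is_lim_seq (fun m => C / INR (2 * m + 1)) 0.
Proof.
replace (Finite 0) with (Rbar_mult C 0) by (simpl; f_equal; ring).
apply (is_lim_seq_scal_l (fun m => / INR (2 * m + 1)) C 0).
apply is_lim_seq_le_le with (fun _ => 0) (fun m => / INR (S m)).
- intros m; split.
  + left; apply Rinv_0_lt_compat, lt_0_INR; lia.
  + apply Rinv_le_contravar; [apply INR_S_pos | apply le_INR; lia].
- apply is_lim_seq_const.
- apply (is_lim_seq_incr_1 (fun n => / INR n)).
  exact (is_lim_seq_inv _ _ is_lim_seq_INR ltac:(discriminate)).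
Qed.

Lemma one_minus_ratio_pos (z : R) (k : nat) : 0 < z < 1 -> 0 < 1 - z ^ 2 / INR (S k) ^ 2.
Proof.
intros Hz.
assert (H : 1 <= INR (S k)) by (change 1 with (INR 1); apply le_INR; lia).
set (s := INR (S k)) in *.
apply Rmult_lt_reg_r with (s ^ 2); [apply pow_lt; lra |].
replace ((1 - z ^ 2 / s ^ 2) * s ^ 2) with (s ^ 2 - z ^ 2) by (field; lra).
nra.
Qed.

Lemma sin_product_pos (z : R) (N : nat) : 0 < z < 1 ->
  0 < prod_f_R0 (fun k => 1 - z ^ 2 / INR (S k) ^ 2) N.
Proof.
intros Hz; induction N; cbn [prod_f_R0].
- now apply one_minus_ratio_pos.
- apply Rmult_lt_0_compat; trivial; now apply one_minus_ratio_pos.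
Qed.

Lemma sin_PI_pos (z : R) : 0 < z < 1 -> 0 < sin (PI * z).
Proof.
intros Hz; assert (H := PI_RGT_0); apply sin_gt_0; nra.
Qed.

Lemma is_lim_seq_sin_product (z : R) : 0 < z < 1 ->
  is_lim_seq (prod_f_R0 (fun k => 1 - z ^ 2 / INR (S k) ^ 2)) (sin (PI * z) / (PI * z)).
Proof.
intros Hz.
assert (Hs := sin_PI_pos z Hz). assert (Hpi := PI_RGT_0).
assert (Hq : 0 < sin (PI * z) / (PI * z)) by (apply Rdiv_lt_0_compat; nra).
pose (rho := fun N => cos_moment (2 * N + 2) (2 * z) / cos_moment (2 * N + 2) 0).
assert (Hrho : is_lim_seq rho 1).
{ apply is_lim_seq_le_const_0 with (1 := fun N => cos_moment_near N (2 * z)), is_lim_seq_div_linear. }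
assert (E : forall N, prod_f_R0 (fun k => 1 - z ^ 2 / INR (S k) ^ 2) N
   = sin (PI * z) / (PI * z) * / rho N).
{ intros N.
  assert (H := sin_eq_partial_product z N ltac:(lra)); fold (rho N) in H.
  assert (HP := sin_product_pos z N Hz).
  assert (rho N <> 0) by (intros H0; rewrite H0, Rmult_0_r in H; lra).
  rewrite H; field; trivial. }
(* The partial products are the limit divided by a ratio that tends to 1. *)
apply is_lim_seq_ext with (1 := fun N => eq_sym (E N)).
replace (sin (PI * z) / (PI * z)) with (sin (PI * z) / (PI * z) * / 1) at 1
  by (rewrite Rinv_1; ring).
apply is_lim_seq_mult'; [apply is_lim_seq_const |].
apply (is_lim_seq_inv rho 1 Hrho). intros H; injection H; lra.
Qed.

Lemma is_series_ln_sin_product (z : R) : 0 < z < 1 ->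
  is_series (fun k => ln (1 - z ^ 2 / INR (S k) ^ 2)) (ln (sin (PI * z) / (PI * z))).
Proof.
intros Hz.
assert (Hs := sin_PI_pos z Hz). assert (Hpi := PI_RGT_0).
assert (L : is_lim_seq (fun N => ln (prod_f_R0 (fun k => 1 - z ^ 2 / INR (S k) ^ 2) N))
   (ln (sin (PI * z) / (PI * z)))).
{ apply is_lim_seq_continuous; [| now apply is_lim_seq_sin_product].
  apply derivable_continuous_pt, ex_derive_Reals_0.
  exists (/ (sin (PI * z) / (PI * z))). apply is_derive_ln, Rdiv_lt_0_compat; nra. }
revert L; apply is_lim_seq_ext; intros N; induction N.
- now rewrite sum_O.
- rewrite sum_Sn, <- IHN; cbn [prod_f_R0].
  apply ln_mult; [now apply sin_product_pos | now apply one_minus_ratio_pos].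
Qed.

Lemma Boule_inside_unit (z : R) : 0 < z < 1 ->
  exists r : posreal, forall y, Boule z r y -> 0 < y < (1 + z) / 2.
Proof.
intros Hz.
assert (Hr : 0 < Rmin z ((1 - z) / 2)) by (apply Rmin_glb_lt; lra).
exists (mkposreal _ Hr); unfold Boule; simpl; intros y Hy.
apply Rabs_def2 in Hy.
assert (H1 := Rmin_l z ((1 - z) / 2)). assert (H2 := Rmin_r z ((1 - z) / 2)). lra.
Qed.

Lemma sq_gap_ge (rho y : R) (k : nat) : 0 <= y < rho -> rho < 1 ->
  (1 - rho ^ 2) * INR (S k) ^ 2 <= INR (S k) ^ 2 - y ^ 2.
Proof.
intros Hy Hr.
assert (H : 1 <= INR (S k)) by (change 1 with (INR 1); apply le_INR; lia).
set (s := INR (S k)) in *.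
assert (y ^ 2 <= rho ^ 2) by nra. assert (1 <= s ^ 2) by nra. nra.
Qed.

Lemma partial_fraction_bound (rho y : R) (k : nat) : 0 <= y < rho -> rho < 1 ->
  Rabs (/ (INR (S k) ^ 2 - y ^ 2)) <= / (1 - rho ^ 2) * / INR (S k) ^ 2.
Proof.
intros Hy Hr.
assert (H := sq_gap_ge rho y k Hy Hr).
assert (Hp : 0 < (1 - rho ^ 2) * INR (S k) ^ 2)
  by (apply Rmult_lt_0_compat; [nra | apply pow_lt, INR_S_pos]).
rewrite Rabs_pos_eq by (left; apply Rinv_0_lt_compat; lra).
rewrite <- Rinv_mult. now apply Rinv_le_contravar.
Qed.

Lemma is_derive_ln_ratio (y : R) (k : nat) : 0 < y < 1 ->
  is_derive (fun y => ln (1 - y ^ 2 / INR (S k) ^ 2)) y (- (2 * y) * / (INR (S k) ^ 2 - y ^ 2)).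
Proof.
intros Hy.
assert (H := one_minus_ratio_pos y k Hy). assert (Hs := INR_S_pos k).
assert (H' := sq_gap_ge ((1 + y) / 2) y k ltac:(lra) ltac:(lra)).
assert (Hp : 0 < (1 - ((1 + y) / 2) ^ 2) * INR (S k) ^ 2)
  by (apply Rmult_lt_0_compat; [nra | apply pow_lt, INR_S_pos]).
set (s := INR (S k)) in *.
auto_derive; [exact H |]. field. simpl in *. repeat split; lra.
Qed.

(** Logarithmic derivative of the product formula for the sine, taken term by
    term on a ball that stays away from 1. *)
Lemma cot_partial_fractions (z : R) : 0 < z < 1 ->
  Series (fun k => - (2 * z) * / (INR (S k) ^ 2 - z ^ 2)) = PI * cos (PI * z) / sin (PI * z) - / z.
Proof.
intros Hz.
assert (Hs := sin_PI_pos z Hz). assert (Hpi := PI_RGT_0).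
destruct (Boule_inside_unit z Hz) as [r Hr].
set (rho := (1 + z) / 2) in *.
assert (Hrho : rho < 1) by (unfold rho; lra).
assert (D : is_derive (fun y => Series (fun k => ln (1 - y ^ 2 / INR (S k) ^ 2))) z
   (Series (fun k => - (2 * z) * / (INR (S k) ^ 2 - z ^ 2)))).
{ apply (is_derive_Series_dominated (fun k y => ln (1 - y ^ 2 / INR (S k) ^ 2))
    (fun k y => - (2 * y) * / (INR (S k) ^ 2 - y ^ 2))
    (fun k => 2 * / (1 - rho ^ 2) * / INR (S k) ^ 2) z r).
  - apply (ex_series_scal (K := R_AbsRing) (V := R_NormedModule)), ex_series_inv_pow; lia.
  - intros k y Hy; apply Hr in Hy; apply is_derive_ln_ratio; lra.
  - intros k y Hy; apply Hr in Hy.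
    assert (H := sq_gap_ge rho y k ltac:(lra) Hrho).
    assert (Hp : 0 < (1 - rho ^ 2) * INR (S k) ^ 2)
      by (apply Rmult_lt_0_compat; [nra | apply pow_lt, INR_S_pos]).
    set (s := INR (S k)) in *.
    apply derivable_continuous_pt, ex_derive_Reals_0; auto_derive.
    simpl in *; lra.
  - intros k y Hy; apply Hr in Hy.
    rewrite Rabs_mult, Rabs_Ropp, (Rabs_pos_eq (2 * y)) by lra.
    rewrite (Rmult_assoc 2 (/ _)). apply Rmult_le_compat; try lra; [apply Rabs_pos |].
    apply partial_fraction_bound; lra.
  - intros y Hy; apply Hr in Hy. eexists; apply is_series_ln_sin_product; lra. }
apply (is_derive_ext_loc _ (fun y => ln (sin (PI * y) / (PI * y)))) in D.
2: { exists r; intros y Hy; apply Hr in Hy.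
     apply is_series_unique, is_series_ln_sin_product; lra. }
rewrite <- (is_derive_unique _ _ _ D).
apply is_derive_unique.
auto_derive.
- split; [nra |]. split; [| trivial]. apply Rdiv_lt_0_compat; nra.
- field. lra.
Qed.

Lemma ex_series_partial_fractions (z : R) : 0 < z < 1 ->
  ex_series (fun k => z ^ 2 * / (INR (S k) ^ 2 - z ^ 2)).
Proof.
intros Hz.
apply (ex_series_scal (K := R_AbsRing) (V := R_NormedModule)).
apply (ex_series_le (K := R_AbsRing) (V := R_CompleteNormedModule) _
  (fun k => / (1 - ((1 + z) / 2) ^ 2) * / INR (S k) ^ 2)).
- intros k; apply partial_fraction_bound; lra.
- apply (ex_series_scal (K := R_AbsRing) (V := R_NormedModule)), ex_series_inv_pow; lia.
Qed.

Lemma zeta_S (s : nat) : s <> O -> zeta s = Series (fun n => / INR (S n) ^ s).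
Proof. now destruct s. Qed.

(** Expanding each partial fraction [z^2 / (k^2 - z^2)] as a geometric series
    and summing over [k] first gives the zeta values.  The exchange of sums is
    elementary: after [N] steps of the geometric expansion the error is the
    series of [z^2 / (k^2 - z^2) * (z/k)^(2N)], at most [z^(2N)] times a
    constant. *)
Lemma is_series_zeta_even (z : R) : 0 < z < 1 ->
  is_series (fun n => zeta (2 * n) * z ^ (2 * n)) (- (PI * z / 2) * (cos (PI * z) / sin (PI * z))).
Proof.
intros Hz.
assert (Hs := sin_PI_pos z Hz).
pose (b := fun k => z ^ 2 * / (INR (S k) ^ 2 - z ^ 2)).
pose (q := fun k => z / INR (S k)).
assert (Hq : forall k, 0 < q k <= z).
{ intros k; assert (H : 1 <= INR (S k)) by (change 1 with (INR 1); apply le_INR; lia).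
  unfold q; split; [apply Rdiv_lt_0_compat; lra |].
  apply Rmult_le_reg_r with (INR (S k)); [lra |].
  unfold Rdiv; rewrite Rmult_assoc, Rinv_l by lra. nra. }
assert (Hb : forall k, 0 < b k).
{ intros k; assert (H : 1 <= INR (S k)) by (change 1 with (INR 1); apply le_INR; lia).
  apply Rmult_lt_0_compat; [nra | apply Rinv_0_lt_compat; nra]. }
assert (Eb : ex_series b) by now apply ex_series_partial_fractions.
assert (Hqz : forall N k, 0 <= q k ^ (2 * N) <= z ^ (2 * N)).
{ intros N k; specialize (Hq k); split; [apply pow_le; lra | apply pow_incr; lra]. }
assert (Ebq : forall N, ex_series (fun k => b k * q k ^ (2 * N))).
{ intros N; apply (ex_series_le (K := R_AbsRing) (V := R_CompleteNormedModule) _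
    (fun k => z ^ (2 * N) * b k)).
  - intros k; change norm with Rabs; specialize (Hb k); specialize (Hqz N k).
    rewrite Rabs_pos_eq; nra.
  - now apply (ex_series_scal (K := R_AbsRing) (V := R_NormedModule)). }
assert (EN : forall N, sum_n (fun n => zeta (2 * n) * z ^ (2 * n)) N
   = - (1 / 2) + Series b - Series (fun k => b k * q k ^ (2 * N))).
{ induction N.
  - rewrite sum_O. simpl zeta. rewrite (Series_ext (fun k => b k * _) b) by (intros; simpl; ring).
    simpl; ring.
  - rewrite sum_Sn, IHN. change plus with Rplus.
    rewrite zeta_S by lia.
    rewrite <- Series_scal_r.
    replace (Series (fun k => b k * q k ^ (2 * N))) with
      (Series (fun k => b k * q k ^ (2 * S N)) + Series (fun n => / INR (S n) ^ (2 * S N) * z ^ (2 * S N))).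
    + match goal with |- @eq _ ?a ?b => change (@eq R a b) end; ring.
    + assert (EX : ex_series (fun n => / INR (S n) ^ (2 * S N) * z ^ (2 * S N))).
      { apply (ex_series_scal_r (z ^ (2 * S N))), ex_series_inv_pow; lia. }
      rewrite <- Series_plus; trivial.
      apply Series_ext; intros k.
      replace (/ INR (S k) ^ (2 * S N) * z ^ (2 * S N)) with (q k ^ (2 * S N))
        by (unfold q, Rdiv; rewrite Rpow_mult_distr, pow_inv; ring).
      replace (2 * S N)%nat with (2 + 2 * N)%nat by lia.
      rewrite pow_add. unfold b, q.
      assert (H : 1 <= INR (S k)) by (change 1 with (INR 1); apply le_INR; lia).
      set (s := INR (S k)) in *.
      field. split; nra. }
unfold is_series.
assert (ES : - (PI * z / 2) * (cos (PI * z) / sin (PI * z)) = - (1 / 2) + Series b).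
{ assert (E := cot_partial_fractions z Hz).
  rewrite Series_scal_l in E. unfold b. rewrite Series_scal_l.
  set (X := Series (fun n => / (INR (S n) ^ 2 - z ^ 2))) in *.
  replace (z ^ 2 * X) with (- (z / 2) * (- (2 * z) * X)) by field.
  rewrite E. field. lra. }
rewrite ES.
apply (is_lim_seq_le_const_0 _ (fun N => (z ^ 2) ^ N * Series b)).
- intros N; rewrite EN.
  replace (_ - _) with (- Series (fun k => b k * q k ^ (2 * N))) by ring.
  rewrite Rabs_Ropp, Rabs_pos_eq.
  + rewrite <- Series_scal_l. apply Series_le.
    * intros k; rewrite <- pow_mult; specialize (Hb k); specialize (Hqz N k); nra.
    * now apply (ex_series_scal (K := R_AbsRing) (V := R_NormedModule)).
  + replace 0 with (Series (fun _ : nat => 0 * 0)) by (rewrite Series_scal_l; ring).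
    apply Series_le; trivial.
    intros k; specialize (Hb k); specialize (Hqz N k); nra.
- replace (Finite 0) with (Rbar_mult 0 (Series b)) by (simpl; f_equal; ring).
  apply is_lim_seq_scal_r, is_lim_seq_geom. rewrite Rabs_pos_eq; nra.
Qed.

(** * Derivatives of the Clausen functions *)

(** Mean value inequality with a majorant [g'] that may vary: [g - f] and
    [g + f] are nondecreasing. *)
Lemma increment_dominated (f f' g g' : R -> R) (a b : R) : a <= b ->
  (forall x, a <= x <= b -> is_derive f x (f' x)) ->
  (forall x, a <= x <= b -> is_derive g x (g' x)) ->
  (forall x, a <= x <= b -> Rabs (f' x) <= g' x) ->
  Rabs (f b - f a) <= g b - g a.
Proof.
intros Hab Hf Hg Hb.
assert (H : forall e, e = 1 \/ e = -1 -> 0 <= (g b - e * f b) - (g a - e * f a)).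
{ intros e He.
  destruct (MVT_gen (fun x => g x - e * f x) a b (fun x => g' x - e * f' x)) as [c [Hc E]];
    rewrite ?Rmin_left, ?Rmax_right by trivial.
  - intros x Hx. apply (is_derive_minus (K := R_AbsRing) (V := R_NormedModule)); [apply Hg; lra |].
    apply is_derive_scal, Hf; lra.
  - intros x Hx. apply derivable_continuous_pt, ex_derive_Reals_0.
    exists (g' x - e * f' x).
    apply (is_derive_minus (K := R_AbsRing) (V := R_NormedModule)); [now apply Hg |].
    now apply is_derive_scal, Hf.
  - rewrite Rmin_left, Rmax_right in Hc by trivial.
    rewrite E. specialize (Hb c Hc). apply Rabs_le_between in Hb.
    apply Rmult_le_pos; [destruct He; subst e; lra | lra]. }
assert (H1 := H 1 (or_introl eq_refl)). assert (H2 := H (-1) (or_intror eq_refl)).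
apply Rabs_le; lra.
Qed.

(** The derivative of the Taylor remainder of [ln (1 + x)] is
    [(-x)^(N+1) / (1 + x)], dominated on the unit interval by that of
    [x^(N+2) / (N+2)]. *)
Lemma alternating_harmonic_error (N : nat) :
  Rabs (sum_n (fun n => (-1) ^ S n / INR (S n)) N + ln 2) <= / INR (S N).
Proof.
pose (f := fun x => sum_n (fun n => (- x) ^ S n / INR (S n)) N + ln (1 + x)).
assert (Hgeom : forall x, 0 <= x -> sum_n (fun n => - (- x) ^ n) N + / (1 + x) = (- x) ^ S N / (1 + x)).
{ intros x Hx; induction N.
  - rewrite sum_O; simpl; field; lra.
  - rewrite sum_Sn; change plus with Rplus.
    replace (sum_n (fun n => - (- x) ^ n) N) with ((- x) ^ S N / (1 + x) - / (1 + x))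
      by (rewrite <- IHN; ring).
    simpl; field; lra. }
assert (H := increment_dominated f (fun x => (- x) ^ S N / (1 + x))
  (fun x => x ^ S (S N) / INR (S (S N))) (fun x => x ^ S N) 0 1 ltac:(lra)).
unfold f in H; cbv beta in H.
replace (sum_n (fun n => (- 0) ^ S n / INR (S n)) N) with 0 in H.
2: { symmetry; rewrite (sum_n_ext _ (fun _ => 0)).
     - rewrite sum_n_const; apply Rmult_0_r.
     - intros n; rewrite Ropp_0, pow_i by lia; apply Rmult_0_l. }
replace (1 + 1) with 2 in H by ring.
rewrite Rplus_0_l, !Rplus_0_r, ln_1, pow1, pow_i, Rdiv_0_l, !Rminus_0_r in H by lia.
eapply Rle_trans; [apply H |].
- intros x Hx; unfold f.
  rewrite <- Hgeom by lra.
  apply (is_derive_plus (K := R_AbsRing) (V := R_NormedModule)).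
  + apply (is_derive_sum_n (K := R_AbsRing) (V := R_NormedModule)); intros k _.
    assert (Hk := INR_S_pos k).
    auto_derive; trivial. change (match k with O => 1 | S _ => INR k + 1 end) with (INR (S k)).
    field; lra.
  + auto_derive; [lra | field; lra].
- intros x _. assert (Hk := INR_S_pos (S N)).
  auto_derive; trivial. change (match N with O => 1 | S _ => INR N + 1 end + 1) with (INR (S (S N))).
  simpl pow; field; lra.
- intros x Hx. unfold Rdiv. rewrite Rabs_mult, <- RPow_abs, Rabs_Ropp, (Rabs_pos_eq x) by lra.
  assert (0 <= x ^ S N) by (apply pow_le; lra).
  rewrite <- (Rmult_1_r (x ^ S N)) at 2.
  apply Rmult_le_compat_l; trivial.
  rewrite Rabs_pos_eq by (left; apply Rinv_0_lt_compat; lra).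
  rewrite <- Rinv_1; apply Rinv_le_contravar; lra.
- assert (Hk := INR_S_pos N). rewrite Rdiv_1_l. apply Rinv_le_contravar; trivial.
  apply le_INR; lia.
Qed.

Lemma Dirichlet_kernel_sin (t : R) (N : nat) :
  2 * sin (t / 2) * sum_n (fun n => sin (INR (S n) * t)) N
  = cos (t / 2) - cos ((INR N + 3 / 2) * t).
Proof.
assert (H : forall x, 2 * sin (t / 2) * sin (x * t) = cos ((x - / 2) * t) - cos ((x + / 2) * t)).
{ intros x. replace ((x - / 2) * t) with (x * t - t / 2) by field.
  replace ((x + / 2) * t) with (x * t + t / 2) by field.
  rewrite cos_minus, cos_plus; ring. }
induction N.
- rewrite sum_O, H; simpl INR. f_equal; f_equal; field.
- rewrite sum_Sn; change plus with Rplus. rewrite Rmult_plus_distr_l, IHN, H, !S_INR.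
  replace ((INR N + 1 + 1 - / 2) * t) with ((INR N + 3 / 2) * t) by field.
  replace ((INR N + 1 + 1 + / 2) * t) with ((INR N + 1 + 3 / 2) * t) by field. ring.
Qed.

Lemma cos_nat_PI (n : nat) : cos (INR n * PI) = (-1) ^ n.
Proof.
induction n.
- simpl; rewrite Rmult_0_l; apply cos_0.
- rewrite S_INR, Rmult_plus_distr_r, Rmult_1_l, neg_cos, IHn; simpl; ring.
Qed.

Lemma sum_n_Ropp (u : nat -> R) (N : nat) : sum_n (fun n => - u n) N = - sum_n u N.
Proof.
induction N; [now rewrite !sum_O | rewrite !sum_Sn, IHN; change plus with Rplus].
symmetry; apply Ropp_plus_distr.
Qed.

(** The error and [sin (M t) / (2 M sin (t/2))], where [M = N + 3/2], have a
    difference [A] whose derivative is [O(1/N)] uniformly where [sin (t/2)] is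
    bounded below: subtracting the second function removes the oscillating
    term [cos (M t) / (2 sin (t/2))] that the Dirichlet kernel leaves.  So the
    error is controlled by its value at [PI], which is that of the alternating
    harmonic series. *)
Lemma cos_sum_error (s t : R) (N : nat) : 0 < s -> 0 < t < 2 * PI ->
  (forall y, Rmin t PI <= y <= Rmax t PI -> s <= sin (y / 2)) ->
  Rabs (sum_n (fun n => cos (INR (S n) * t) / INR (S n)) N + ln (2 * sin (t / 2)))
  <= (2 + 4 / s ^ 2 + / s) / INR (S N).
Proof.
intros Hs Ht Hsin.
set (M := INR N + 3 / 2).
assert (HN := INR_S_pos N).
assert (HM : INR (S N) <= 2 * M) by (rewrite S_INR; assert (H := pos_INR N); unfold M; lra).
assert (Hpi := PI_RGT_0).
pose (A := fun y => sum_n (fun n => cos (INR (S n) * y) / INR (S n)) N + ln (2 * sin (y / 2))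
  - sin (M * y) / (2 * M * sin (y / 2))).
pose (A' := fun y => sin (M * y) * cos (y / 2) / (4 * M * sin (y / 2) ^ 2)).
assert (HA : forall y, Rmin t PI <= y <= Rmax t PI -> is_derive A y (A' y)).
{ intros y Hy; specialize (Hsin y Hy). unfold A.
  evar_last.
  - apply (is_derive_minus (K := R_AbsRing) (V := R_NormedModule)).
    + apply (is_derive_plus (K := R_AbsRing) (V := R_NormedModule)).
      * apply (is_derive_sum_n (K := R_AbsRing) (V := R_NormedModule) (fun n y => cos (INR (S n) * y) / INR (S n)) _ _ (fun n => - sin (INR (S n) * y))); intros k _.
        assert (Hk := INR_S_pos k). set (q := INR (S k)) in *.
        auto_derive; trivial. field; lra.
      * auto_derive; [lra | reflexivity].
    + auto_derive; [| reflexivity]. repeat split; trivial.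
      apply Rmult_integral_contrapositive; split; lra.
  - assert (E := Dirichlet_kernel_sin y N). fold M in E.
    change minus with Rminus; change plus with Rplus.
    assert (E' : @eq R (sum_n (fun n => - sin (INR (S n) * y)) N)
      (- ((cos (y / 2) - cos (M * y)) / (2 * sin (y / 2))))).
    { rewrite sum_n_Ropp, <- E. field. lra. }
    unfold A'. match goal with |- @eq _ (_ + ?c - ?d) _ => apply (eq_trans (f_equal (fun v => v + c - d) E')) end.
    cbv beta; match goal with |- @eq _ ?a ?b => change (@eq R a b) end.
    change (y * / 2) with (y / 2).
    field. lra. }
assert (HB : forall y, Rmin t PI <= y <= Rmax t PI -> Rabs (A' y) <= / s ^ 2 * / INR (S N)).
{ intros y Hy; specialize (Hsin y Hy). unfold A', Rdiv.
  assert (Hq : s ^ 2 * INR (S N) <= 4 * M * sin (y / 2) ^ 2).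
  { rewrite (Rmult_comm (4 * M)). apply Rmult_le_compat; try lra; [apply pow_le; lra |].
    apply pow_incr; lra. }
  assert (Hq0 : 0 < s ^ 2 * INR (S N)) by (apply Rmult_lt_0_compat; trivial; apply pow_lt; lra).
  rewrite <- Rinv_mult, Rabs_mult, <- (Rmult_1_l (/ (s ^ 2 * _))).
  apply Rmult_le_compat; try apply Rabs_pos.
  - rewrite Rabs_mult, <- (Rmult_1_l 1).
    apply Rmult_le_compat; try apply Rabs_pos; apply Rabs_le; [apply SIN_bound | apply COS_bound].
  - rewrite Rabs_pos_eq by (left; apply Rinv_0_lt_compat; lra). now apply Rinv_le_contravar. }
assert (HD : Rabs (A t - A PI) <= / s ^ 2 * / INR (S N) * 4).
{ destruct (MVT_gen A PI t A') as [c [Hc E]]; rewrite ?(Rmin_comm PI), ?(Rmax_comm PI) in *.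
  - intros x Hx; apply HA; lra.
  - intros x Hx; apply derivable_continuous_pt, ex_derive_Reals_0; eexists; now apply HA.
  - rewrite E, Rabs_mult. apply Rmult_le_compat; try apply Rabs_pos; [now apply HB |].
    assert (H4 := PI_4). apply Rabs_le; lra. }
assert (HP : Rabs (A PI) <= 2 / INR (S N)).
{ unfold A. rewrite sin_PI2, !Rmult_1_r.
  rewrite (sum_n_ext _ (fun n => (-1) ^ S n / INR (S n))) by (intros; now rewrite cos_nat_PI).
  assert (H1 := alternating_harmonic_error N).
  assert (H2 : Rabs (sin (M * PI) / (2 * M)) <= / INR (S N)).
  { unfold Rdiv. rewrite Rabs_mult, <- (Rmult_1_l (/ INR (S N))).
    apply Rmult_le_compat; try apply Rabs_pos; [apply Rabs_le, SIN_bound |].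
    rewrite Rabs_pos_eq by (left; apply Rinv_0_lt_compat; lra). now apply Rinv_le_contravar. }
  eapply Rle_trans; [apply Rabs_triang |]. rewrite Rabs_Ropp. lra. }
assert (HL : Rabs (sin (M * t) / (2 * M * sin (t / 2))) <= / s * / INR (S N)).
{ specialize (Hsin t (conj (Rmin_l _ _) (Rmax_l _ _))).
  assert (Hq : s * INR (S N) <= 2 * M * sin (t / 2)) by nra.
  assert (Hq0 : 0 < s * INR (S N)) by (apply Rmult_lt_0_compat; trivial).
  unfold Rdiv. rewrite <- Rinv_mult, Rabs_mult, <- (Rmult_1_l (/ (s * _))).
  apply Rmult_le_compat; try apply Rabs_pos; [apply Rabs_le, SIN_bound |].
  rewrite Rabs_pos_eq by (left; apply Rinv_0_lt_compat; lra). now apply Rinv_le_contravar. }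
replace (_ + ln _) with ((A t - A PI) + A PI + sin (M * t) / (2 * M * sin (t / 2))) by (unfold A; ring).
eapply Rle_trans; [apply Rabs_triang |].
eapply Rle_trans; [apply Rplus_le_compat_r, Rabs_triang |].
replace (_ / INR (S N)) with (/ s ^ 2 * / INR (S N) * 4 + 2 / INR (S N) + / s * / INR (S N))
  by (field; lra).
lra.
Qed.

Lemma sin_ge_on (a x : R) : 0 <= a <= PI / 2 -> a <= x <= PI - a -> sin a <= sin x.
Proof.
intros Ha Hx.
destruct (Rle_dec x (PI / 2)).
- apply sin_incr_1; lra.
- rewrite <- (sin_PI_x x). apply sin_incr_1; lra.
Qed.

Lemma ex_series_trig (u : nat -> R) (k : nat) : (2 <= k)%nat ->
  (forall n, Rabs (u n) <= 1) -> ex_series (fun n => u n / INR (S n) ^ k).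
Proof.
intros Hk Hu.
apply (ex_series_le (K := R_AbsRing) (V := R_CompleteNormedModule) _ (fun n => / INR (S n) ^ k)).
- intros n; change norm with Rabs. unfold Rdiv.
  assert (H : 0 < / INR (S n) ^ k) by apply Rinv_0_lt_compat, pow_lt, INR_S_pos.
  rewrite Rabs_mult, (Rabs_pos_eq (/ _)) by lra.
  specialize (Hu n). nra.
- now apply ex_series_inv_pow.
Qed.

(** The series of derivatives is not dominated; its uniform convergence near
    [t] is the estimate [cos_sum_error], used on an interval [[a, 2 PI - a]]
    that contains both a neighbourhood of [t] and [PI]. *)
Lemma is_derive_Cl_2 (t : R) : 0 < t < 2 * PI ->
  is_derive (Cl 2) t (- ln (2 * sin (t / 2))).
Proof.
intros Ht.
(* The same [a] serves as radius around [t] and as distance to 0 and [2 PI]. *)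
pose (a := Rmin t (2 * PI - t) / 2).
assert (Ha : 0 < a) by (apply Rdiv_lt_0_compat; [apply Rmin_glb_lt |]; lra).
assert (Ha1 := Rmin_l t (2 * PI - t)). assert (Ha2 := Rmin_r t (2 * PI - t)).
pose (s := sin (a / 2)).
assert (Hs : 0 < s) by (apply sin_gt_0; unfold a in *; lra).
assert (HB : forall y, Boule t (mkposreal a Ha) y -> a < y < 2 * PI - a).
{ intros y Hy; unfold Boule in Hy; simpl in Hy; apply Rabs_def2 in Hy. unfold a in *; lra. }
assert (Hsin : forall y, a <= y <= 2 * PI - a -> s <= sin (y / 2)).
{ intros y Hy; apply sin_ge_on; unfold a in *; lra. }
apply is_derive_Reals.
apply (derivable_pt_lim_CVU (fun N y => sum_n (fun n => sin (INR (S n) * y) / INR (S n) ^ 2) N)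
  (fun N y => sum_n (fun n => cos (INR (S n) * y) / INR (S n)) N) _
  (fun y => - ln (2 * sin (y / 2))) t t (mkposreal a Ha)).
- unfold Boule; rewrite Rminus_diag, Rabs_R0; apply Ha.
- intros y N Hy; apply is_derive_Reals.
  apply (is_derive_sum_n (K := R_AbsRing) (V := R_NormedModule)
    (fun n y => sin (INR (S n) * y) / INR (S n) ^ 2)); intros k _.
  assert (Hk := INR_S_pos k). set (q := INR (S k)) in *.
  auto_derive; trivial. field; lra.
- intros y Hy. apply is_lim_seq_Series_pointwise.
  apply ex_series_trig; [lia | intros; apply Rabs_le, SIN_bound].
- intros eps Heps.
  set (C := 2 + 4 / s ^ 2 + / s).
  assert (L : is_lim_seq (fun N => C / INR (S N)) 0).
  { replace (Finite 0) with (Rbar_mult C 0) by (simpl; f_equal; ring).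
    apply (is_lim_seq_scal_l (fun N => / INR (S N)) C 0), (is_lim_seq_incr_1 (fun n => / INR n)).
    exact (is_lim_seq_inv _ _ is_lim_seq_INR ltac:(discriminate)). }
  apply is_lim_seq_spec in L. destruct (L (mkposreal eps Heps)) as [N HN]; simpl in HN.
  exists N; intros n y Hn Hy; apply HB in Hy.
  specialize (HN n Hn). rewrite Rminus_0_r in HN.
  assert (H := cos_sum_error s y n Hs).
  rewrite Rabs_minus_sym. unfold Rminus at 1. rewrite Ropp_involutive.
  eapply Rle_lt_trans; [apply H |].
  + unfold a in *; lra.
  + intros x Hx; apply Hsin.
    assert (Hm : a <= Rmin y PI) by (apply Rmin_glb; unfold a in *; lra).
    assert (HM : Rmax y PI <= 2 * PI - a) by (apply Rmax_lub; unfold a in *; lra). lra.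
  + fold C. eapply Rle_lt_trans; [apply Rle_abs | exact HN].
- intros y Hy; apply HB in Hy. specialize (Hsin y ltac:(lra)).
  apply derivable_continuous_pt, ex_derive_Reals_0; auto_derive; lra.
Qed.

(** The sign is that of the derivative of the sine (if [k + 1] is even) or of
    the cosine (if [k + 1] is odd). *)
Lemma is_derive_Cl_S (k : nat) (t : R) : (2 <= k)%nat ->
  is_derive (Cl (S k)) t ((-1) ^ S k * Cl k t).
Proof.
intros Hk. unfold Cl. rewrite Nat.even_succ, <- Nat.negb_even.
destruct (Nat.even k) eqn:Ev; simpl negb; cbv iota.
- replace ((-1) ^ S k) with (-1).
  2: { apply Nat.even_spec in Ev. destruct Ev as [j Hj]. subst k. rewrite pow_1_odd; reflexivity. }
  rewrite <- Series_scal_l.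
  apply (is_derive_Series_dominated (fun n t => cos (INR (S n) * t) / INR (S n) ^ S k)
     (fun n t => -1 * (sin (INR (S n) * t) / INR (S n) ^ k))
     (fun n => / INR (S n) ^ k) t (mkposreal 1 Rlt_0_1)).
  + now apply ex_series_inv_pow.
  + intros n y _. assert (Hq := INR_S_pos n). set (q := INR (S n)) in *.
    assert (Hqk : 0 < q ^ k) by now apply pow_lt.
    auto_derive; trivial. simpl. field. lra.
  + intros n y _. apply derivable_continuous_pt, ex_derive_Reals_0; auto_derive; trivial.
  + intros n y _. assert (H : 0 < / INR (S n) ^ k) by apply Rinv_0_lt_compat, pow_lt, INR_S_pos.
    unfold Rdiv. rewrite !Rabs_mult, (Rabs_pos_eq (/ _)) by lra.
    replace (Rabs (-1)) with 1 by (rewrite Rabs_left; lra).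
    assert (Hb : Rabs (sin (INR (S n) * y)) <= 1) by apply Rabs_le, SIN_bound. nra.
  + intros y _. apply ex_series_trig; [lia | intros; apply Rabs_le, COS_bound].
- replace ((-1) ^ S k) with 1.
  2: { assert (Od := Nat.negb_even k). rewrite Ev in Od; symmetry in Od; apply Nat.odd_spec in Od.
       destruct Od as [j Hj]. subst k. replace (S (2 * j + 1)) with (2 * S j)%nat by lia. rewrite pow_1_even; reflexivity. }
  rewrite Rmult_1_l.
  apply (is_derive_Series_dominated (fun n t => sin (INR (S n) * t) / INR (S n) ^ S k)
     (fun n t => cos (INR (S n) * t) / INR (S n) ^ k)
     (fun n => / INR (S n) ^ k) t (mkposreal 1 Rlt_0_1)).
  + now apply ex_series_inv_pow.
  + intros n y _. assert (Hq := INR_S_pos n). set (q := INR (S n)) in *.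
    assert (Hqk : 0 < q ^ k) by now apply pow_lt.
    auto_derive; trivial. simpl. field. lra.
  + intros n y _. apply derivable_continuous_pt, ex_derive_Reals_0; auto_derive; trivial.
  + intros n y _. assert (H : 0 < / INR (S n) ^ k) by apply Rinv_0_lt_compat, pow_lt, INR_S_pos.
    unfold Rdiv. rewrite !Rabs_mult, (Rabs_pos_eq (/ _)) by lra.
    assert (Hb : Rabs (cos (INR (S n) * y)) <= 1) by apply Rabs_le, COS_bound. nra.
  + intros y _. apply ex_series_trig; [lia | intros; apply Rabs_le, SIN_bound].
Qed.

Lemma continuity_pt_Cl (k : nat) (t : R) : (2 <= k)%nat -> continuity_pt (Cl k) t.
Proof.
intros Hk. unfold Cl.
assert (HT : forall u : R -> R, (forall x, continuity_pt u x) -> (forall x, -1 <= u x <= 1) ->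
  continuity_pt (fun t => Series (fun n => u (INR (S n) * t) / INR (S n) ^ k)) t).
{ intros u Hu Hb.
  apply (continuity_pt_Series_dominated (fun n t => u (INR (S n) * t) / INR (S n) ^ k)
    (fun n => / INR (S n) ^ k) t (mkposreal 1 Rlt_0_1)).
  - now apply ex_series_inv_pow.
  - intros n y _. assert (H : 0 < / INR (S n) ^ k) by apply Rinv_0_lt_compat, pow_lt, INR_S_pos.
    unfold Rdiv. rewrite !Rabs_mult, (Rabs_pos_eq (/ _)) by lra.
    assert (Hc : Rabs (u (INR (S n) * y)) <= 1) by apply Rabs_le, Hb. nra.
  - intros n y _. unfold Rdiv. apply continuity_pt_mult.
    + apply (continuity_pt_comp (fun y => INR (S n) * y) u); [| apply Hu].
      apply derivable_continuous_pt, ex_derive_Reals_0; auto_derive; trivial.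
    + now apply continuity_pt_const.
  - unfold Boule; rewrite Rminus_diag, Rabs_R0; apply Rlt_0_1. }
destruct (Nat.even k).
- apply (HT sin); [apply continuity_sin | apply SIN_bound].
- apply (HT cos); [apply continuity_cos | apply COS_bound].
Qed.

(** * Iterated primitives of the zeta series *)

(** The sign [(-1)^(k + k/2)] makes each function the derivative of the next
    one on the open unit interval, and the two lowest levels, whose Clausen
    series do not converge absolutely, are given by their closed forms. *)
Definition clausen_tower (k : nat) (z : R) : R :=
  match k with
  | O => cos (PI * z) / (2 * sin (PI * z))
  | 1%nat => ln (2 * sin (PI * z)) / (2 * PI)
  | _ => (-1) ^ (k + k / 2) * Cl k (2 * PI * z) / (2 * PI) ^ k
  end.

Lemma tower_Cl (k : nat) (z : R) : (2 <= k)%nat ->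
  clausen_tower k z = (-1) ^ (k + k / 2) * Cl k (2 * PI * z) / (2 * PI) ^ k.
Proof. intros Hk; destruct k as [|[|k]]; [lia | lia | reflexivity]. Qed.

(** The compatibility of the signs of consecutive levels of the tower. *)
Lemma half_succ_sign (k : nat) : (-1) ^ (S k / 2) = (-1) ^ (k + k / 2).
Proof.
destruct (Nat.Even_or_Odd k) as [[i ->] | [i ->]].
- replace (S (2 * i)) with (1 + i * 2)%nat by lia. rewrite Nat.div_add by lia.
  rewrite (Nat.mul_comm 2 i), Nat.div_mul by lia.
  change (1 / 2)%nat with O; rewrite Nat.add_0_l.
  rewrite pow_add, (Nat.mul_comm i 2), pow_1_even; ring.
- replace (S (2 * i + 1)) with (S i * 2)%nat by lia. rewrite Nat.div_mul by lia.
  replace (2 * i + 1)%nat with (1 + i * 2)%nat by lia. rewrite Nat.div_add by lia.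
  change (1 / 2)%nat with O; rewrite Nat.add_0_l.
  rewrite !pow_add, (Nat.mul_comm i 2), pow_1_even; simpl; ring.
Qed.

Lemma is_derive_tower (k : nat) (z : R) : 0 < z < 1 -> is_derive (clausen_tower (S k)) z (clausen_tower k z).
Proof.
intros Hz. assert (Hs := sin_PI_pos z Hz). assert (Hpi := PI_RGT_0).
destruct k as [|k].
- unfold clausen_tower. auto_derive; [lra | field; lra].
- assert (Hc : forall l, is_derive (Cl (S (S k))) (2 * PI * z) l ->
    is_derive (clausen_tower (S (S k))) z ((-1) ^ (S (S k) + S (S k) / 2) * l / (2 * PI) ^ S k)).
  { intros l Hl. unfold clausen_tower.
    evar_last.
    - apply (is_derive_ext (fun x => (-1) ^ (S (S k) + S (S k) / 2) / (2 * PI) ^ S (S k) * Cl (S (S k)) (2 * PI * x))).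
      { intros t; real_eq; unfold Rdiv; ring. }
      apply is_derive_scal, (is_derive_comp (Cl (S (S k))) (fun x => 2 * PI * x)); [exact Hl |].
      apply (is_derive_scal (fun x => x)), (is_derive_id (K := R_AbsRing)).
    - unfold scal, one; simpl; unfold mult, one; simpl. assert (0 < (2 * PI) ^ k) by (apply pow_lt; lra). field. lra. }
  destruct k as [|k].
  + evar_last; [apply Hc, is_derive_Cl_2; nra |].
    unfold clausen_tower. replace (2 * PI * z / 2) with (PI * z) by field.
    change (2 + 2 / 2)%nat with 3%nat. simpl. field; lra.
  + evar_last; [apply Hc, is_derive_Cl_S; lia |].
    rewrite (tower_Cl (S (S k))) by lia.
    rewrite pow_add, (half_succ_sign (S (S k))).
    set (s := (-1) ^ (S (S k) + S (S k) / 2)). set (c := Cl _ _).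
    assert (E : (-1) ^ S (S (S k)) * (-1) ^ S (S (S k)) = 1) by (rewrite <- Rpow_mult_distr; replace (-1 * -1) with 1 by ring; apply pow1).
    transitivity ((-1) ^ S (S (S k)) * (-1) ^ S (S (S k)) * s * c / (2 * PI) ^ S (S k)).
    * unfold Rdiv; ring.
    * rewrite E; unfold Rdiv; ring.
Qed.

Lemma continuity_pt_tower (k : nat) (z : R) : (2 <= k)%nat -> continuity_pt (clausen_tower k) z.
Proof.
intros Hk.
apply continuity_pt_ext with (fun z => (-1) ^ (k + k / 2) / (2 * PI) ^ k * Cl k (2 * PI * z)).
- intros t; rewrite tower_Cl by trivial; unfold Rdiv; ring.
- apply (continuity_pt_scal (fun z => Cl k (2 * PI * z))).
  apply (continuity_pt_comp (fun z => 2 * PI * z) (Cl k)); [| now apply continuity_pt_Cl].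
  apply derivable_continuous_pt, ex_derive_Reals_0; auto_derive; trivial.
Qed.

Lemma tower_even_0 (i : nat) : (1 <= i)%nat -> clausen_tower (2 * i) 0 = 0.
Proof.
intros Hi. rewrite tower_Cl by lia. unfold Cl. rewrite Nat.even_mul; simpl orb; cbv iota.
rewrite (Series_ext _ (fun n => 0 * 0)).
- rewrite Series_scal_l. unfold Rdiv; ring.
- intros n; rewrite !Rmult_0_r, sin_0; unfold Rdiv; ring.
Qed.

Lemma tower_odd_0 (i : nat) : (1 <= i)%nat ->
  clausen_tower (2 * i + 1) 0 = - (-1) ^ i * zeta (2 * i + 1) / (2 * PI) ^ (2 * i + 1).
Proof.
intros Hi. rewrite tower_Cl by lia. unfold Cl.
replace (Nat.even (2 * i + 1)) with false.
2: { rewrite Nat.even_add, Nat.even_mul; reflexivity. }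
rewrite zeta_S by lia.
rewrite (Series_ext _ (fun n => / INR (S n) ^ (2 * i + 1))).
2: { intros n; rewrite !Rmult_0_r, cos_0; unfold Rdiv; ring. }
replace ((2 * i + 1) / 2)%nat with i.
2: { replace (2 * i + 1)%nat with (1 + i * 2)%nat by lia. now rewrite Nat.div_add by lia. }
rewrite !(pow_add (-1)), pow_1_even. unfold Rdiv; simpl; ring.
Qed.

(** Continuity is two-sided because [ln] is 0 on nonpositive numbers.  For
    [z > 0] the factor [z] beats the logarithm: [sin (PI z)] is at least of
    order [z], and [ln y < y] at [y = 1 / sqrt z] gives the bound
    [2 sqrt z]. *)
Lemma continuity_pt_z_tower_1 : continuity_pt (fun z => z * clausen_tower 1 z) 0.
Proof.
assert (Hpi := PI_RGT_0). assert (Hpi4 := PI_4).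
assert (Hpi3 : 3 <= 2 * PI) by (assert (H := PI2_3_2); lra).
assert (Hb : forall z, Rabs z < / 3 -> Rabs (z * ln (2 * sin (PI * z))) <= 2 * sqrt (Rabs z)).
{ intros z Hz. apply Rabs_def2 in Hz.
  destruct (Rle_dec z 0) as [Hneg | Hpos].
  - assert (Hs : sin (PI * z) <= 0).
    { rewrite <- (Ropp_involutive (PI * z)), sin_neg.
      assert (0 <= sin (- (PI * z))) by (apply sin_ge_0; nra). lra. }
    replace (ln (2 * sin (PI * z))) with 0.
    + rewrite Rmult_0_r, Rabs_R0. apply Rmult_le_pos; [lra | apply sqrt_pos].
    + unfold ln. destruct (Rlt_dec 0 (2 * sin (PI * z))); [exfalso; lra | reflexivity].
  - assert (Hz0 : 0 < z) by lra. rewrite (Rabs_pos_eq z) by lra.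
    assert (Hc : / 2 <= cos (PI * z)).
    { rewrite <- Rdiv_1_l, <- cos_PI3. apply cos_decr_1; nra. }
    assert (H1 := x_cos_le_sin (PI * z) ltac:(nra)).
    assert (H2 := SIN_bound (PI * z)).
    assert (Hy : z <= 2 * sin (PI * z)).
    { assert (PI * z * / 2 <= PI * z * cos (PI * z)) by (apply Rmult_le_compat_l; nra). nra. }
    assert (Hr := sqrt_lt_R0 z Hz0). assert (Hrr := sqrt_sqrt z ltac:(lra)).
    assert (Hln : forall x, 0 < x -> ln x < x).
    { intros x Hx. assert (H := exp_ineq1_le (ln x)). rewrite exp_ln in H by trivial. lra. }
    assert (Hup : ln (2 * sin (PI * z)) <= 1).
    { assert (H := exp_ineq1_le (ln (2 * sin (PI * z)))). rewrite exp_ln in H by lra. lra. }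
    assert (Hlo : - ln (2 * sin (PI * z)) <= 2 * / sqrt z).
    { apply Rle_trans with (- ln z).
      - apply Ropp_le_contravar. destruct Hy as [Hy | <-]; [left; now apply ln_increasing | lra].
      - rewrite <- Hrr at 1. rewrite ln_mult by trivial.
        assert (H := Hln (/ sqrt z) (Rinv_0_lt_compat _ Hr)). rewrite ln_Rinv in H by trivial. lra. }
    rewrite Rabs_mult, (Rabs_pos_eq z) by lra.
    set (r := sqrt z) in *.
    assert (Hr1 : r < 1) by nra.
    replace (2 * r) with (z * (2 * / r)) by (rewrite <- Hrr; field; lra).
    apply Rmult_le_compat_l; [lra |].
    assert (1 <= / r) by (rewrite <- Rinv_1; apply Rinv_le_contravar; lra).
    apply Rabs_le; lra. }
intros eps Heps.
(* The second bound makes [2 * sqrt (Rabs z)] smaller than [eps]. *)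
pose (d := Rmin (/ 3) ((eps / 2) ^ 2)).
exists d; split.
- apply Rmin_glb_lt; [lra | apply pow_lt; lra].
- intros z [_ Hd]. unfold Rlimit.dist in *; simpl in *; unfold Rdist in *.
  rewrite Rminus_0_r in Hd. rewrite Rmult_0_l, Rminus_0_r.
  assert (H1 : Rabs z < / 3) by (eapply Rlt_le_trans; [apply Hd | apply Rmin_l]).
  assert (H2 : Rabs z < (eps / 2) ^ 2) by (eapply Rlt_le_trans; [apply Hd | apply Rmin_r]).
  assert (H3 : sqrt (Rabs z) < eps / 2).
  { rewrite <- (sqrt_pow2 (eps / 2)) by lra. apply sqrt_lt_1_alt; split; [apply Rabs_pos | exact H2]. }
  assert (H4 := Hb z H1).
  replace (z * (ln (2 * sin (PI * z)) / (2 * PI))) with (z * ln (2 * sin (PI * z)) * / (2 * PI))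
    by (unfold Rdiv; ring).
  rewrite Rabs_mult, (Rabs_pos_eq (/ _)) by (left; apply Rinv_0_lt_compat; lra).
  assert (H5 : / (2 * PI) <= 1) by (rewrite <- Rinv_1; apply Rinv_le_contravar; lra).
  assert (H6 : 0 < / (2 * PI)) by (apply Rinv_0_lt_compat; lra).
  assert (H7 := Rabs_pos (z * ln (2 * sin (PI * z)))).
  nra.
Qed.

Lemma ex_series_even_powers (b : nat -> R) (B z : R) (q : nat) :
  (forall n, Rabs (b n) <= B) -> Rabs z < 1 -> ex_series (fun n => b n * z ^ (2 * n + q)).
Proof.
intros Hb Hz.
apply (ex_series_le (K := R_AbsRing) (V := R_CompleteNormedModule) _ (fun n => B * (Rabs z ^ 2) ^ n)).
- intros n; change norm with Rabs.
  rewrite Rabs_mult, <- RPow_abs, pow_add, <- pow_mult.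
  assert (H := Rabs_pos z).
  assert (H1 : 0 <= Rabs z ^ (2 * n)) by now apply pow_le.
  assert (H2 : 0 <= Rabs z ^ q <= 1) by (split; [now apply pow_le | rewrite <- (pow1 q); apply pow_incr; lra]).
  apply Rmult_le_compat; [apply Rabs_pos | nra | apply Hb | nra].
- apply (ex_series_scal (K := R_AbsRing) (V := R_NormedModule)), ex_series_geom.
  assert (H := Rabs_pos z). rewrite Rabs_pos_eq; nra.
Qed.

Lemma is_derive_even_powers (b : nat -> R) (B z : R) (q : nat) :
  (forall n, Rabs (b n) <= B) -> Rabs z < 1 ->
  is_derive (fun z => Series (fun n => b n / INR (2 * n + S q) * z ^ (2 * n + S q))) z
    (Series (fun n => b n * z ^ (2 * n + q))).
Proof.
intros Hb Hz.
set (rho := (1 + Rabs z) / 2).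
assert (Hr : 0 < (1 - Rabs z) / 2) by lra.
assert (Hz0 := Rabs_pos z).
assert (HB : forall y, Boule z (mkposreal _ Hr) y -> Rabs y <= rho).
{ intros y Hy; unfold Boule in Hy; simpl in Hy.
  assert (H := Rabs_triang_inv y z). unfold rho; lra. }
assert (Hq : forall n, 1 <= INR (2 * n + S q)) by (intros n; change 1 with (INR 1); apply le_INR; lia).
assert (HB0 : 0 <= B) by (eapply Rle_trans; [apply Rabs_pos | apply (Hb O)]).
apply (is_derive_Series_dominated (fun n z => b n / INR (2 * n + S q) * z ^ (2 * n + S q))
  (fun n z => b n * z ^ (2 * n + q)) (fun n => B * (rho ^ 2) ^ n) z (mkposreal _ Hr)).
- apply (ex_series_scal (K := R_AbsRing) (V := R_NormedModule)), ex_series_geom.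
  unfold rho; rewrite Rabs_pos_eq; nra.
- intros n y _. specialize (Hq n). evar_last.
  + apply is_derive_scal, (is_derive_pow (fun y => y)), (is_derive_id (K := R_AbsRing)).
  + rewrite Nat.add_succ_r in *. simpl pred. unfold one; simpl. field. simpl in Hq. lra.
- intros n y _. apply derivable_continuous_pt, ex_derive_Reals_0; auto_derive; trivial.
- intros n y Hy; apply HB in Hy.
  rewrite Rabs_mult, <- RPow_abs, pow_add, <- pow_mult.
  assert (H := Rabs_pos y).
  assert (H1 : 0 <= Rabs y ^ (2 * n) <= rho ^ (2 * n)) by (split; [now apply pow_le | apply pow_incr; lra]).
  assert (H2 : 0 <= Rabs y ^ q <= 1) by (split; [now apply pow_le | rewrite <- (pow1 q); apply pow_incr; unfold rho in *; lra]).
  apply Rmult_le_compat; [apply Rabs_pos | nra | apply Hb | nra].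
- intros y Hy; apply HB in Hy.
  apply ex_series_even_powers with B; [| unfold rho in *; lra].
  intros n; unfold Rdiv; rewrite Rabs_mult, (Rabs_pos_eq (/ _)).
  + assert (H : / INR (2 * n + S q) <= 1) by (rewrite <- Rinv_1; apply Rinv_le_contravar; [lra | apply Hq]).
    assert (H' : 0 < / INR (2 * n + S q)) by (apply Rinv_0_lt_compat; specialize (Hq n); lra).
    specialize (Hb n). assert (H0 := Rabs_pos (b n)). nra.
  + left; apply Rinv_0_lt_compat; specialize (Hq n); lra.
Qed.

(** [(2n+1) (2n+2) ... (2n+j)], with [j] factors, so that the empty product
    at [j = 0] corresponds to no integration. *)
Fixpoint rising_prod (j n : nat) : R :=
  match j with
  | O => 1
  | S j' => rising_prod j' n * INR (2 * n + j)
  end.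

Lemma consecutive_prod_rising (n m : nat) : consecutive_prod n m = rising_prod (S m) n.
Proof.
unfold consecutive_prod; induction m.
- cbn [prod_f_R0 rising_prod]; ring.
- cbn [prod_f_R0]; rewrite IHm; reflexivity.
Qed.

Lemma rising_ge_1 (j n : nat) : 1 <= rising_prod j n.
Proof.
induction j; cbn [rising_prod]; [lra |].
assert (H : 1 <= INR (2 * n + S j)) by (change 1 with (INR 1); apply le_INR; lia). nra.
Qed.

Lemma zeta_even_bounded (n : nat) : 0 <= Rabs (zeta (2 * n)) <= zeta 2.
Proof.
split; [apply Rabs_pos |].
assert (Hex := ex_series_inv_pow 2 ltac:(lia)).
assert (Hp : forall k n, 0 < / INR (S n) ^ k) by (intros; apply Rinv_0_lt_compat, pow_lt, INR_S_pos).
destruct n as [|n].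
- replace (zeta (2 * 0)) with (- (1 / 2)) by reflexivity. rewrite Rabs_left by lra.
  rewrite zeta_S, Series_incr_1 by (trivial || lia).
  assert (0 <= Series (fun k => / INR (S (S k)) ^ 2)).
  { replace 0 with (Series (fun _ : nat => 0 * 0)) by (rewrite Series_scal_l; ring).
    apply Series_le; [| exact (proj1 (ex_series_incr_1 (fun k => / INR (S k) ^ 2)) Hex)].
    intros k; specialize (Hp 2%nat (S k)); lra. }
  change (INR 1) with 1. rewrite pow1, Rinv_1; lra.
- rewrite !zeta_S by lia.
  rewrite Rabs_pos_eq.
  + apply Series_le; trivial. intros k; split; [left; apply Hp |].
    apply Rinv_le_contravar; [apply pow_lt, INR_S_pos |].
    apply Rle_pow; [change 1 with (INR 1); apply le_INR; lia | lia].
  + replace 0 with (Series (fun _ : nat => 0 * 0)) by (rewrite Series_scal_l; ring).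
    apply Series_le; [| apply ex_series_inv_pow; lia].
    intros k; specialize (Hp (2 * S n)%nat k); lra.
Qed.

Lemma zeta_rising_bounded (j n : nat) : Rabs (zeta (2 * n) / rising_prod j n) <= zeta 2.
Proof.
assert (H := rising_ge_1 j n). assert (Hz := zeta_even_bounded n).
unfold Rdiv; rewrite Rabs_mult, (Rabs_pos_eq (/ _)) by (left; apply Rinv_0_lt_compat; lra).
assert (/ rising_prod j n <= 1) by (rewrite <- Rinv_1; apply Rinv_le_contravar; lra).
assert (0 < / rising_prod j n) by (apply Rinv_0_lt_compat; lra). nra.
Qed.

(** The [j]-fold primitive, vanishing at 0 together with its lower primitives, of
    the series of [zeta (2n) z^(2n)]. *)
Definition zeta_primitive (j : nat) (z : R) : R :=
  Series (fun n => zeta (2 * n) / rising_prod j n * z ^ (2 * n + j)).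

Lemma is_derive_zeta_primitive (j : nat) (z : R) : Rabs z < 1 ->
  is_derive (zeta_primitive (S j)) z (zeta_primitive j z).
Proof.
intros Hz. unfold zeta_primitive.
apply (is_derive_ext (fun z => Series (fun n => zeta (2 * n) / rising_prod j n / INR (2 * n + S j) * z ^ (2 * n + S j)))).
- intros t; apply Series_ext; intros n; cbn [rising_prod].
  f_equal; unfold Rdiv; rewrite Rinv_mult; ring.
- apply is_derive_even_powers with (zeta 2); trivial. apply zeta_rising_bounded.
Qed.

Lemma Series_powers_0 (c : nat -> R) (q : nat) : Series (fun n => c n * 0 ^ (2 * n + S q)) = 0.
Proof.
rewrite (Series_ext _ (fun n => 0 * 0)).
- rewrite Series_scal_l; ring.
- intros n; rewrite pow_i by lia; ring.
Qed.

(** The constant of integration that makes the [l]-th primitive vanish at 0.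
    For odd [l] it is 0; for [l = 2i] it is a multiple of [zeta (2i+1)].  At
    [l = 0] the factor [INR l] cancels the meaningless [clausen_tower 1 0]. *)
Definition odd_zeta_coef (l : nat) : R := - PI * INR l * clausen_tower (S l) 0.

Definition odd_zeta_poly (j : nat) (z : R) : R :=
  sum_n (fun l => odd_zeta_coef l * z ^ (j - l) / INR (fact (j - l))) j.

Lemma is_derive_odd_zeta_poly (j : nat) (z : R) :
  is_derive (odd_zeta_poly (S j)) z (odd_zeta_poly j z).
Proof.
unfold odd_zeta_poly.
apply (is_derive_ext (fun z => sum_n (fun l => odd_zeta_coef l * z ^ (S j - l) / INR (fact (S j - l))) j + odd_zeta_coef (S j))).
- intros t; rewrite sum_Sn, Nat.sub_diag; change plus with Rplus; simpl. f_equal; field.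
- rewrite <- (Rplus_0_r (sum_n _ j)).
  apply (is_derive_plus (K := R_AbsRing) (V := R_NormedModule)); [| apply (is_derive_const (K := R_AbsRing) (V := R_NormedModule))].
  apply (is_derive_sum_n (K := R_AbsRing) (V := R_NormedModule)
    (fun l z => odd_zeta_coef l * z ^ (S j - l) / INR (fact (S j - l)))); intros l Hl.
  replace (S j - l)%nat with (S (j - l)) by lia. set (i := (j - l)%nat).
  assert (Hi := INR_fact_neq_0 i). assert (Hi1 := INR_S_pos i).
  replace (INR (fact (S i))) with (INR (S i) * INR (fact i)) by (rewrite <- mult_INR; reflexivity).
  set (f := INR (fact i)) in *.
  auto_derive; trivial. change (match i with O => 1 | S _ => INR i + 1 end) with (INR (S i)).
  field. lra.
Qed.

Lemma odd_zeta_poly_0 (j : nat) : odd_zeta_poly j 0 = odd_zeta_coef j.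
Proof.
unfold odd_zeta_poly. destruct j as [|j].
- rewrite sum_O; simpl; field.
- rewrite sum_Sn, (sum_n_ext_loc _ (fun _ => 0)).
  + rewrite sum_n_const, Nat.sub_diag; change plus with Rplus; simpl; field.
  + intros l Hl; rewrite pow_i by lia; unfold Rdiv; real_eq; ring.
Qed.

(** The closed form of [zeta_primitive]. *)
Definition primitive_form (j : nat) (z : R) : R :=
  PI * (- (z * clausen_tower j z) + INR j * clausen_tower (S j) z) + odd_zeta_poly j z.

Lemma is_derive_Rmult (f g : R -> R) (x a b : R) : is_derive f x a -> is_derive g x b ->
  is_derive (fun y => f y * g y) x (a * g x + f x * b).
Proof. intros Hf Hg; exact (is_derive_mult (K := R_AbsRing) f g x a b Hf Hg Rmult_comm). Qed.

Lemma is_derive_primitive_form (j : nat) (z : R) : 0 < z < 1 ->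
  is_derive (primitive_form (S j)) z (primitive_form j z).
Proof.
intros Hz. unfold primitive_form.
apply (is_derive_plus (K := R_AbsRing) (V := R_NormedModule)); [| apply is_derive_odd_zeta_poly].
apply is_derive_scal.
evar_last.
- apply (is_derive_plus (K := R_AbsRing) (V := R_NormedModule)).
  + apply (is_derive_opp (K := R_AbsRing) (V := R_NormedModule)), is_derive_Rmult.
    * apply (is_derive_id (K := R_AbsRing)).
    * now apply is_derive_tower.
  + now apply is_derive_scal, is_derive_tower.
- rewrite S_INR. real_eq. change plus with Rplus; change opp with Ropp; change one with 1. ring.
Qed.

Lemma continuity_pt_primitive_form_0 (j : nat) : continuity_pt (primitive_form (S j)) 0.
Proof.
unfold primitive_form. apply continuity_pt_plus.
- apply (continuity_pt_scal (fun z => - (z * clausen_tower (S j) z) + INR (S j) * clausen_tower (S (S j)) z)).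
  apply continuity_pt_plus.
  + apply (continuity_pt_opp (fun z => z * clausen_tower (S j) z)).
    destruct j as [|j]; [apply continuity_pt_z_tower_1 |].
    apply (continuity_pt_mult (fun z => z)); [| apply continuity_pt_tower; lia].
    apply continuity_pt_id.
  + apply (continuity_pt_scal (clausen_tower (S (S j)))), continuity_pt_tower; lia.
- apply derivable_continuous_pt, ex_derive_Reals_0. eexists; apply is_derive_odd_zeta_poly.
Qed.

(** Differentiability is required only in the open interval, because the lower
    levels of the tower are singular at 0. *)
Lemma eq_of_same_derivative (f g h : R -> R) (z : R) : 0 < z < 1 ->
  (forall x, 0 < x < 1 -> is_derive f x (h x)) ->
  (forall x, 0 < x < 1 -> is_derive g x (h x)) ->
  continuity_pt f 0 -> continuity_pt g 0 -> f 0 = g 0 -> f z = g z.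
Proof.
intros Hz Hf Hg Cf Cg H0.
destruct (MVT_gen (fun x => f x - g x) 0 z (fun _ => 0)) as [c [_ E]];
  rewrite ?Rmin_left, ?Rmax_right by lra.
- intros x Hx. replace 0 with (h x - h x) by ring.
  apply (is_derive_minus (K := R_AbsRing) (V := R_NormedModule)); [apply Hf | apply Hg]; lra.
- intros x Hx. apply continuity_pt_minus.
  + destruct (Req_dec x 0) as [-> | Hx0]; trivial.
    apply derivable_continuous_pt, ex_derive_Reals_0; eexists; apply Hf; lra.
  + destruct (Req_dec x 0) as [-> | Hx0]; trivial.
    apply derivable_continuous_pt, ex_derive_Reals_0; eexists; apply Hg; lra.
- lra.
Qed.

(** Induction on the number of integrations, starting from the cotangent; both
    sides vanish at 0 and are continuous there. *)
Lemma zeta_primitive_eq (j : nat) (z : R) : 0 < z < 1 -> zeta_primitive j z = primitive_form j z.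
Proof.
revert z; induction j; intros z Hz.
- unfold zeta_primitive, primitive_form, odd_zeta_poly, odd_zeta_coef.
  rewrite sum_O. rewrite (Series_ext _ (fun n => zeta (2 * n) * z ^ (2 * n))).
  2: { intros n; rewrite Nat.add_0_r; simpl; unfold Rdiv; rewrite Rinv_1; ring. }
  rewrite (is_series_unique _ _ (is_series_zeta_even z Hz)).
  assert (Hs := sin_PI_pos z Hz). unfold clausen_tower at 1. simpl INR. simpl fact. simpl INR. field. lra.
- apply eq_of_same_derivative with (primitive_form j); trivial.
  + intros x Hx; rewrite <- IHj by trivial. apply is_derive_zeta_primitive, Rabs_def1; lra.
  + apply is_derive_primitive_form.
  + apply derivable_continuous_pt, ex_derive_Reals_0; eexists.
    apply is_derive_zeta_primitive; rewrite Rabs_R0; lra.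
  + apply continuity_pt_primitive_form_0.
  + unfold zeta_primitive; rewrite Series_powers_0.
    unfold primitive_form; rewrite odd_zeta_poly_0; unfold odd_zeta_coef. ring.
Qed.

(** * The weighted primitive and the closed form *)

(** The integral of [t^p D_k t] from 0 to [z], where [D] is the tower, by
    repeated integration by parts. *)
Fixpoint tower_moment (p k : nat) (z : R) : R :=
  match p with
  | O => clausen_tower (S k) z - clausen_tower (S k) 0
  | S p' => z ^ p * clausen_tower (S k) z - INR p * tower_moment p' (S k) z
  end.

Lemma is_derive_pow_S (p : nat) (z : R) : is_derive (fun z => z ^ S p) z (INR (S p) * z ^ p).
Proof.
evar_last; [apply (is_derive_pow (fun z => z)), (is_derive_id (K := R_AbsRing)) |].
real_eq; change one with 1; simpl pred; ring.
Qed.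

Lemma is_derive_moment (p k : nat) (z : R) : 0 < z < 1 ->
  is_derive (tower_moment p k) z (z ^ p * clausen_tower k z).
Proof.
intros Hz; revert k; induction p; intros k; cbn [tower_moment].
- evar_last.
  + apply (is_derive_minus (K := R_AbsRing) (V := R_NormedModule)).
    * now apply is_derive_tower.
    * apply (is_derive_const (K := R_AbsRing) (V := R_NormedModule)).
  + real_eq; change minus with Rminus; change zero with 0; simpl; ring.
- evar_last.
  + apply (is_derive_minus (K := R_AbsRing) (V := R_NormedModule)).
    * apply is_derive_Rmult; [apply is_derive_pow_S | now apply is_derive_tower].
    * apply is_derive_scal, IHp.
  + real_eq; change minus with Rminus; cbv beta; ring.
Qed.

Lemma continuity_pt_moment_0 (p k : nat) : (1 <= k)%nat -> continuity_pt (tower_moment p k) 0.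
Proof.
revert k; induction p; intros k Hk; cbn [tower_moment].
- apply continuity_pt_minus; [apply continuity_pt_tower; lia | now apply continuity_pt_const].
- apply continuity_pt_minus.
  + apply (continuity_pt_mult (fun z => z ^ S p)); [| apply continuity_pt_tower; lia].
    apply derivable_continuous_pt, ex_derive_Reals_0; auto_derive; trivial.
  + apply (continuity_pt_scal (tower_moment p (S k))), IHp; lia.
Qed.

Lemma moment_0 (p k : nat) : tower_moment p k 0 = 0.
Proof.
revert k; induction p; intros k; cbn [tower_moment]; [ring |].
rewrite IHp, pow_i by lia; ring.
Qed.

(** The recursion unrolled; the last term is the contribution of the lower
    endpoint 0, which only survives when no power of [z] is left. *)
Lemma moment_expand (p k : nat) (z : R) :
  tower_moment p k z = INR (fact p)
    * (sum_n_m (fun K => (-1) ^ (K + k + 1) * z ^ (p + k + 1 - K) / INR (fact (p + k + 1 - K)) * clausen_tower K z)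
         (k + 1) (k + 1 + p)
       - (-1) ^ p * clausen_tower (k + 1 + p) 0).
Proof.
revert k; induction p; intros k; cbn [tower_moment].
- rewrite Nat.add_0_r, sum_n_n, Nat.sub_diag.
  replace (k + 1 + k + 1)%nat with (2 * (k + 1))%nat by lia. rewrite pow_1_even.
  replace (k + 1)%nat with (S k) by lia. simpl; field.
- rewrite IHp, (sum_Sn_m _ (k + 1)) by lia. change plus with Rplus.
  rewrite (sum_n_m_ext_loc (fun K => (-1) ^ (K + S k + 1) * _ / _ * _)
    (fun K => mult (-1) ((-1) ^ (K + k + 1) * z ^ (S p + k + 1 - K) / INR (fact (S p + k + 1 - K)) * clausen_tower K z))).
  2: { intros K HK. replace (p + S k + 1 - K)%nat with (S p + k + 1 - K)%nat by lia.
       replace (K + S k + 1)%nat with (S (K + k + 1)) by lia. change mult with Rmult.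
       real_eq. unfold Rdiv; simpl pow. ring. }
  rewrite (sum_n_m_mult_l (K := R_Ring)). change mult with Rmult.
  replace (S k + 1)%nat with (S (k + 1)) by lia.
  replace (S (k + 1) + p)%nat with (k + 1 + S p)%nat by lia.
  replace (S p + k + 1 - (k + 1))%nat with (S p) by lia.
  replace (k + 1 + k + 1)%nat with (2 * (k + 1))%nat by lia. rewrite pow_1_even.
  replace (INR (fact (S p))) with (INR (S p) * INR (fact p)) by (rewrite <- mult_INR; reflexivity).
  set (Sg := sum_n_m _ _ _). 
  replace (clausen_tower (S k) z) with (clausen_tower (k + 1) z) by (f_equal; lia).
  assert (H1 := INR_fact_neq_0 p). assert (H2 := INR_S_pos p).
  set (f := INR (fact p)) in *. set (q := INR (S p)) in *. 
  simpl pow. field. lra.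
Qed.

(** Integrating [z^p * primitive_form j z] from 0: one integration by parts of
    the term with [z^(p+1)] merges it with the other one into a single
    [tower_moment], with the factor [p + j + 1]. *)
Definition weighted_form (p j : nat) (z : R) : R :=
  PI * (- (z ^ S p * clausen_tower (S j) z) + INR (p + j + 1) * tower_moment p (S j) z)
  + sum_n (fun l => odd_zeta_coef l * z ^ (p + j + 1 - l) / (INR (fact (j - l)) * INR (p + j + 1 - l))) j.

Lemma is_derive_weighted_poly (p j : nat) (z : R) :
  is_derive (fun z => sum_n (fun l => odd_zeta_coef l * z ^ (p + j + 1 - l) / (INR (fact (j - l)) * INR (p + j + 1 - l))) j)
    z (z ^ p * odd_zeta_poly j z).
Proof.
assert (E : z ^ p * odd_zeta_poly j z = sum_n (fun l => z ^ p * (odd_zeta_coef l * z ^ (j - l) / INR (fact (j - l)))) j).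
{ symmetry. unfold odd_zeta_poly. apply (sum_n_mult_l (K := R_Ring)). }
rewrite E.
apply (is_derive_sum_n (K := R_AbsRing) (V := R_NormedModule)
  (fun l z => odd_zeta_coef l * z ^ (p + j + 1 - l) / (INR (fact (j - l)) * INR (p + j + 1 - l)))); intros l Hl.
replace (p + j + 1 - l)%nat with (S (p + (j - l))) by lia. set (i := (j - l)%nat).
assert (Hi := INR_fact_neq_0 i). assert (Hi1 := INR_S_pos (p + i)).
apply (is_derive_ext (fun z => odd_zeta_coef l / (INR (fact i) * INR (S (p + i))) * z ^ S (p + i))).
{ intros t; real_eq; unfold Rdiv; ring. }
evar_last; [apply is_derive_scal, is_derive_pow_S |].
real_eq. rewrite pow_add. set (f := INR (fact i)) in *. set (q := INR (S (p + i))) in *. field. lra.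
Qed.

Lemma is_derive_weighted_form (p j : nat) (z : R) : 0 < z < 1 ->
  is_derive (weighted_form p j) z (z ^ p * primitive_form j z).
Proof.
intros Hz. unfold weighted_form.
evar_last.
- apply (is_derive_plus (K := R_AbsRing) (V := R_NormedModule)); [| apply is_derive_weighted_poly].
  apply is_derive_scal.
  apply (is_derive_plus (K := R_AbsRing) (V := R_NormedModule)).
  + apply (is_derive_opp (K := R_AbsRing) (V := R_NormedModule)), is_derive_Rmult;
      [apply is_derive_pow_S | now apply is_derive_tower].
  + now apply is_derive_scal, is_derive_moment.
- real_eq; change plus with Rplus; change opp with Ropp. unfold primitive_form.
  rewrite !plus_INR, S_INR; simpl; ring.
Qed.

Lemma continuity_pt_weighted_form_0 (p m : nat) : continuity_pt (weighted_form p (S m)) 0.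
Proof.
unfold weighted_form. apply continuity_pt_plus.
- apply (continuity_pt_scal (fun z => - (z ^ S p * clausen_tower (S (S m)) z) + INR (p + S m + 1) * tower_moment p (S (S m)) z)).
  apply continuity_pt_plus.
  + apply (continuity_pt_opp (fun z => z ^ S p * clausen_tower (S (S m)) z)).
    apply (continuity_pt_mult (fun z => z ^ S p)); [| apply continuity_pt_tower; lia].
    apply derivable_continuous_pt, ex_derive_Reals_0; auto_derive; trivial.
  + apply (continuity_pt_scal (tower_moment p (S (S m)))), continuity_pt_moment_0; lia.
- apply derivable_continuous_pt, ex_derive_Reals_0. eexists; apply is_derive_weighted_poly.
Qed.

Lemma weighted_form_0 (p j : nat) : weighted_form p j 0 = 0.
Proof.
unfold weighted_form. rewrite moment_0, pow_i, (sum_n_ext_loc _ (fun _ => 0)), sum_n_const.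
- ring.
- intros l Hl; rewrite pow_i by lia. real_eq; unfold Rdiv; ring.
- lia.
Qed.

Lemma weighted_series_eq (p m : nat) (z : R) : 0 < z < 1 ->
  Series (fun n => zeta (2 * n) / rising_prod (S m) n / INR (2 * n + S (p + S m)) * z ^ (2 * n + S (p + S m)))
  = weighted_form p (S m) z.
Proof.
intros Hz.
assert (D : forall x, Rabs x < 1 -> is_derive (fun z => Series (fun n => zeta (2 * n) / rising_prod (S m) n
  / INR (2 * n + S (p + S m)) * z ^ (2 * n + S (p + S m)))) x
  (Series (fun n => zeta (2 * n) / rising_prod (S m) n * x ^ (2 * n + (p + S m))))).
{ intros x Hx. apply is_derive_even_powers with (zeta 2); trivial. apply zeta_rising_bounded. }
apply (eq_of_same_derivative (fun z => Series (fun n => zeta (2 * n) / rising_prod (S m) n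
  / INR (2 * n + S (p + S m)) * z ^ (2 * n + S (p + S m)))) (weighted_form p (S m))
  (fun x => x ^ p * primitive_form (S m) x)); trivial.
- intros x Hx. evar_last; [apply D, Rabs_def1; lra |].
  rewrite <- zeta_primitive_eq by trivial. unfold zeta_primitive. rewrite <- Series_scal_l.
  apply Series_ext; intros n. replace (2 * n + (p + S m))%nat with (p + (2 * n + S m))%nat by lia.
  rewrite (pow_add x p). ring.
- apply is_derive_weighted_form.
- apply derivable_continuous_pt, ex_derive_Reals_0; eexists; apply D; rewrite Rabs_R0; lra.
- apply continuity_pt_weighted_form_0.
- rewrite Series_powers_0, weighted_form_0; reflexivity.
Qed.

(** The constants of integration vanish for odd indices, so that only the odd
    zeta values remain in the sum. *)
Lemma sum_n_even_support (g : nat -> R) (j : nat) : g O = 0 ->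
  (forall i, g (2 * i + 1)%nat = 0) -> sum_n g j = sum_n_m (fun i => g (2 * i)%nat) 1 (j / 2).
Proof.
intros H0 H1.
assert (H : forall i, sum_n g (2 * i) = sum_n_m (fun i => g (2 * i)%nat) 1 i).
{ induction i.
  - rewrite sum_n_m_zero by lia. rewrite sum_O; exact H0.
  - replace (2 * S i)%nat with (S (S (2 * i))) by lia.
    rewrite !sum_Sn, sum_n_Sm, IHi by lia.
    replace (S (2 * i)) with (2 * i + 1)%nat by lia. rewrite H1.
    replace (S (2 * i + 1)) with (2 * S i)%nat by lia.
    change plus with Rplus; real_eq; ring. }
destruct (Nat.Even_or_Odd j) as [[i ->] | [i ->]].
- rewrite (Nat.mul_comm 2 i), Nat.div_mul, (Nat.mul_comm i 2) by lia. apply H.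
- replace ((2 * i + 1) / 2)%nat with i.
  + replace (2 * i + 1)%nat with (S (2 * i)) by lia. rewrite sum_Sn, H.
    replace (S (2 * i)) with (2 * i + 1)%nat by lia. rewrite H1. apply Rplus_0_r.
  + replace (2 * i + 1)%nat with (1 + i * 2)%nat by lia. now rewrite Nat.div_add by lia.
Qed.

Definition closed_form (p m : nat) (z : R) : R :=
    (INR (p + m + 2)
     * ((-1) ^ (m + 1) * INR (fact p)
          * sum_n_m
              (fun k : nat =>
                 PI * z * (-1) ^ (k / 2) * Cl k (2 * PI * z)
                 / (INR (fact (p + m + 3 - k)) * (2 * PI * z) ^ k))
              (m + 3) (p + m + 3)
        - kronecker (INR ((p + m) / 2)) (INR (p + m) / 2)
          * (INR (fact p) * (-1) ^ ((p + m) / 2) * (-1) ^ m * zeta (p + m + 3)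
             / (2 * (2 * PI * z) ^ (m + p + 2))))
     + (-1) ^ ((m + 1) / 2) * Cl (m + 2) (2 * PI * z)
       / (2 * (2 * PI * z) ^ (m + 1))
     + sum_n_m
         (fun k : nat =>
            INR k * (-1) ^ k * zeta (2 * k + 1)
            / ((2 * PI * z) ^ (2 * k) * INR (fact (m + 1 - 2 * k))
               * INR (m + p + 2 - 2 * k)))
         1 ((m + 1) / 2)).

Lemma pow_m1_sq (n : nat) : (-1) ^ n * (-1) ^ n = 1.
Proof. rewrite <- Rpow_mult_distr; replace (-1 * -1) with 1 by ring; apply pow1. Qed.

Lemma odd_zeta_part (p m : nat) (z : R) : 0 < z ->
  sum_n (fun l => odd_zeta_coef l * z ^ (p + S m + 1 - l) / (INR (fact (S m - l)) * INR (p + S m + 1 - l))) (S m)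
  = z ^ (m + p + 2) * sum_n_m
         (fun k : nat =>
            INR k * (-1) ^ k * zeta (2 * k + 1)
            / ((2 * PI * z) ^ (2 * k) * INR (fact (m + 1 - 2 * k))
               * INR (m + p + 2 - 2 * k)))
         1 ((m + 1) / 2).
Proof.
intros Hz. assert (Hpi := PI_RGT_0).
rewrite sum_n_even_support.
- replace (m + 1)%nat with (S m) by lia.
  rewrite <- (sum_n_m_mult_l (K := R_Ring)). apply sum_n_m_ext_loc; intros k Hk.
  assert (Hk2 : (2 * k <= S m)%nat).
  { assert (H := Nat.div_mod (S m) 2 ltac:(lia)). lia. }
  replace (p + S m + 1 - 2 * k)%nat with (m + p + 2 - 2 * k)%nat by lia.
  unfold odd_zeta_coef. replace (S (2 * k)) with (2 * k + 1)%nat by lia.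
  rewrite tower_odd_0 by lia.
  assert (E : z ^ (m + p + 2) = z ^ (m + p + 2 - 2 * k) * z ^ (2 * k)) by (rewrite <- pow_add; f_equal; lia).
  change mult with Rmult. rewrite E, (Rpow_mult_distr (2 * PI) z), (pow_add (2 * PI)), mult_INR. change (INR 2) with 2. rewrite pow_1.
  assert (H1 := INR_fact_neq_0 (S m - 2 * k)).
  assert (H2 : 0 < INR (m + p + 2 - 2 * k)) by (apply lt_0_INR; lia).
  assert (H3 : 0 < (2 * PI) ^ (2 * k)) by (apply pow_lt; lra).
  assert (H4 : 0 < z ^ (2 * k)) by (apply pow_lt; lra).
  real_eq. field. repeat split; lra.
- unfold odd_zeta_coef; simpl; unfold Rdiv; ring.
- intros i. unfold odd_zeta_coef. replace (S (2 * i + 1)) with (2 * S i)%nat by lia.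
  rewrite tower_even_0 by lia. unfold Rdiv; ring.
Qed.

(** The value of the tower at 0 is 0 at even levels and a zeta value at odd
    levels, whence the Kronecker delta. *)
Lemma constant_part (p m : nat) (z : R) : 0 < z ->
  PI * ((-1) ^ p * clausen_tower (p + m + 3) 0)
  = z ^ (m + p + 2) * (kronecker (INR ((p + m) / 2)) (INR (p + m) / 2)
          * ((-1) ^ ((p + m) / 2) * (-1) ^ m * zeta (p + m + 3)
             / (2 * (2 * PI * z) ^ (m + p + 2)))).
Proof.
intros Hz. assert (Hpi := PI_RGT_0). unfold kronecker.
destruct (Nat.Even_or_Odd (p + m)) as [[i Hi] | [i Hi]].
- rewrite (Nat.add_comm m p), Hi. rewrite (Nat.mul_comm 2 i), Nat.div_mul, (Nat.mul_comm i 2) by lia.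
  destruct (Req_dec_T (INR i) (INR (2 * i) / 2)) as [_ | H].
  2: { exfalso; apply H; rewrite mult_INR; change (INR 2) with 2; field. }
  replace (2 * i + 3)%nat with (2 * S i + 1)%nat by lia. rewrite tower_odd_0 by lia.
  assert (E : (-1) ^ p = (-1) ^ m).
  { assert (H : (-1) ^ p * (-1) ^ m = 1) by (rewrite <- pow_add, Hi; apply pow_1_even).
    assert (H' := pow_m1_sq m). nra. }
  rewrite E. replace (2 * S i + 1)%nat with (S (2 * i + 2)) at 2 by lia.
  rewrite (Rpow_mult_distr (2 * PI) z).
  assert (H3 : 0 < (2 * PI) ^ (2 * i + 2)) by (apply pow_lt; lra).
  assert (H4 : 0 < z ^ (2 * i + 2)) by (apply pow_lt; lra).
  set (a := (2 * PI) ^ (2 * i + 2)) in *. set (b := z ^ (2 * i + 2)) in *.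
  rewrite <- !tech_pow_Rmult. fold a. field. lra.
- replace (p + m + 3)%nat with (2 * (i + 2))%nat by lia. rewrite tower_even_0 by lia.
  destruct (Req_dec_T _ _) as [H | _]; [exfalso | ring].
  assert (H' : INR (2 * ((p + m) / 2)) = INR (p + m)) by (rewrite mult_INR, H; change (INR 2) with 2; field).
  apply INR_eq in H'. lia.
Qed.

Lemma weighted_form_eq (p m : nat) (z : R) : 0 < z ->
  weighted_form p (S m) z = z ^ (m + p + 2) * closed_form p m z.
Proof.
intros Hz. assert (Hpi := PI_RGT_0).
unfold weighted_form, closed_form. rewrite odd_zeta_part by trivial.
rewrite !(Rmult_plus_distr_l (z ^ _)). f_equal.
rewrite (Rmult_plus_distr_l PI), Rplus_comm. f_equal.
- rewrite moment_expand.
  replace (p + S m + 1)%nat with (p + m + 2)%nat by lia.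
  replace (S (S m) + 1 + p)%nat with (p + m + 3)%nat by lia.
  replace (S (S m) + 1)%nat with (m + 3)%nat by lia.
  assert (E := constant_part p m z Hz).
  assert (E2 : PI * sum_n_m (fun K : nat => (-1) ^ (K + S (S m) + 1) * z ^ (p + S (S m) + 1 - K)
       / INR (fact (p + S (S m) + 1 - K)) * clausen_tower K z) (m + 3) (p + m + 3)
    = z ^ (m + p + 2) * ((-1) ^ (m + 1) * sum_n_m
              (fun k : nat =>
                 PI * z * (-1) ^ (k / 2) * Cl k (2 * PI * z)
                 / (INR (fact (p + m + 3 - k)) * (2 * PI * z) ^ k))
              (m + 3) (p + m + 3))).
  { rewrite <- Rmult_assoc.
    rewrite <- !(sum_n_m_mult_l (K := R_Ring)). apply sum_n_m_ext_loc; intros k Hk.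
    change mult with Rmult. rewrite tower_Cl by lia.
    replace (p + S (S m) + 1 - k)%nat with (p + m + 3 - k)%nat by lia.
    replace (k + S (S m) + 1)%nat with (k + 2 + (m + 1))%nat by lia.
    assert (Ez : z * z ^ (m + p + 2) = z ^ (p + m + 3 - k) * z ^ k)
      by (rewrite <- pow_add, tech_pow_Rmult; f_equal; lia).
    rewrite !(pow_add (-1)), (Rpow_mult_distr _ z k).
    assert (H1 := INR_fact_neq_0 (p + m + 3 - k)).
    assert (H3 : 0 < (2 * PI) ^ k) by (apply pow_lt; lra).
    assert (H4 : 0 < z ^ k) by (apply pow_lt; lra).
    assert (H5 := pow_m1_sq k).
    set (f := INR (fact _)) in *. set (s := (-1) ^ k) in *. set (c := Cl _ _).
    set (t := (-1) ^ (k / 2)). set (P := (2 * PI) ^ k) in *. set (y := z ^ k) in *.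
    real_eq.
    replace (z ^ (m + p + 2)) with (z ^ (p + m + 3 - k) * y / z) by (rewrite <- Ez; field; lra).
    transitivity (s * s * (PI * ((-1) ^ m * (-1) ^ 1) * z ^ (p + m + 3 - k) * t * c / (f * P))).
    - simpl. field. lra.
    - rewrite H5. field. lra. }
  set (Sa := sum_n_m _ _ _) in *. set (Sb := sum_n_m _ _ _) in *.
  set (kr := kronecker _ _) in *. 
  transitivity (INR (p + m + 2) * INR (fact p) * (PI * Sa - PI * ((-1) ^ p * clausen_tower (p + m + 3) 0))); [ring |].
  rewrite E2, E. unfold Rdiv. ring.
- rewrite tower_Cl by lia.
  replace (m + 1)%nat with (S m) by lia. replace (m + 2)%nat with (S (S m)) by lia.
  rewrite pow_add, (half_succ_sign (S m)).
  set (c := Cl _ _). set (t := (-1) ^ (S m + S m / 2)).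
  replace ((-1) ^ (S m / 2)) with (- (-1) ^ S (S m) * t).
  2: { unfold t; rewrite pow_add. assert (H := pow_m1_sq m).
       rewrite <- !(tech_pow_Rmult (-1)).
       transitivity ((-1) ^ m * (-1) ^ m * (-1) ^ (S m / 2)); [ring | rewrite H; ring]. }
  replace (m + p + 2)%nat with (S p + S m)%nat by lia.
  rewrite (pow_add z), (Rpow_mult_distr _ z).
  assert (H3 : 0 < (2 * PI) ^ S m) by (apply pow_lt; lra).
  assert (H4 : 0 < z ^ S m) by (apply pow_lt; lra).
  rewrite <- (tech_pow_Rmult (2 * PI) (S m)).
  set (P := (2 * PI) ^ S m) in *. set (y := z ^ S m) in *. field. lra.
Qed.

Lemma Cl_opp (k : nat) (t : R) : Cl k (- t) = - (-1) ^ k * Cl k t.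
Proof.
unfold Cl. destruct (Nat.Even_or_Odd k) as [[i ->] | [i ->]].
- rewrite Nat.even_mul, pow_1_even; simpl orb; cbv iota. rewrite <- Series_scal_l.
  apply Series_ext; intros n. rewrite Ropp_mult_distr_r_reverse, sin_neg. unfold Rdiv; ring.
- rewrite Nat.even_add, Nat.even_mul; cbn [Nat.even orb Bool.eqb].
  rewrite <- Series_scal_l.
  apply Series_ext; intros n. rewrite Ropp_mult_distr_r_reverse, cos_neg, (pow_add (-1)), pow_1_even.
  unfold Rdiv; simpl; ring.
Qed.

Lemma pow_opp (x : R) (k : nat) : (- x) ^ k = (-1) ^ k * x ^ k.
Proof. replace (- x) with (-1 * x) by ring; apply Rpow_mult_distr. Qed.

(** Each term contains [Cl_k (w) / w^k], which is odd in [w], times an odd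
    power of [w] or [z], or else an even power of [w]; where the Kronecker delta
    is nonzero, [m + p + 2] is even. *)
Lemma closed_form_opp (p m : nat) (z : R) : 0 < z -> closed_form p m (- z) = closed_form p m z.
Proof.
intros Hz. assert (Hpi := PI_RGT_0). unfold closed_form.
replace (2 * PI * - z) with (- (2 * PI * z)) by ring.
assert (Hw : 0 < 2 * PI * z) by nra. set (w := 2 * PI * z) in *.
assert (Hwk : forall k, 0 < w ^ k) by (intros; now apply pow_lt).
f_equal; [f_equal |].
- f_equal. f_equal.
  + f_equal. apply sum_n_m_ext; intros k. rewrite Cl_opp, pow_opp.
    assert (H1 := INR_fact_neq_0 (p + m + 3 - k)). specialize (Hwk k).
    assert (H2 : (-1) ^ k <> 0) by (apply pow_nonzero; lra).
    set (f := INR (fact _)) in *. set (c := Cl _ _). set (t := (-1) ^ (k / 2)). set (s := (-1) ^ k) in *.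
    real_eq. field. lra.
  + unfold kronecker. destruct (Req_dec_T _ _) as [H | _]; [| ring].
    assert (H' : INR (2 * ((p + m) / 2)) = INR (p + m)) by (rewrite mult_INR, H; change (INR 2) with 2; field).
    apply INR_eq in H'.
    rewrite pow_opp. replace (m + p + 2)%nat with (2 * ((p + m) / 2 + 1))%nat at 1 by lia.
    rewrite pow_1_even, (Rmult_1_l (w ^ _)). reflexivity.
- rewrite Cl_opp, pow_opp. replace (m + 2)%nat with (S (m + 1)) by lia.
  rewrite <- (tech_pow_Rmult (-1)). specialize (Hwk (m + 1)%nat).
  assert (H2 : (-1) ^ (m + 1) <> 0) by (apply pow_nonzero; lra).
  set (c := Cl _ _). set (t := (-1) ^ ((m + 1) / 2)). field. lra.
- apply sum_n_m_ext; intros k. rewrite pow_opp, pow_1_even, Rmult_1_l. reflexivity.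
Qed.

Lemma is_series_closed_form (p m : nat) (z : R) : 0 < z < 1 ->
  is_series (fun n => zeta (2 * n) * z ^ (2 * n) / (consecutive_prod n m * INR (2 * n + m + p + 2)))
    (closed_form p m z).
Proof.
intros Hz.
pose (b := fun n => zeta (2 * n) / (consecutive_prod n m * INR (2 * n + m + p + 2))).
assert (Hb : forall n, zeta (2 * n) / rising_prod (S m) n / INR (2 * n + S (p + S m)) = b n).
{ intros n; unfold b. rewrite consecutive_prod_rising.
  replace (2 * n + S (p + S m))%nat with (2 * n + m + p + 2)%nat by lia.
  unfold Rdiv; rewrite Rinv_mult; ring. }
assert (HB : forall n, Rabs (b n) <= zeta 2).
{ intros n. rewrite <- Hb. unfold Rdiv at 1. rewrite Rabs_mult.
  assert (H := zeta_rising_bounded (S m) n). assert (H0 := Rabs_pos (zeta (2 * n) / rising_prod (S m) n)).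
  assert (H1 : 1 <= INR (2 * n + S (p + S m))) by (change 1 with (INR 1); apply le_INR; lia).
  assert (H2 : 0 < / INR (2 * n + S (p + S m))) by (apply Rinv_0_lt_compat; lra).
  assert (H3 : / INR (2 * n + S (p + S m)) <= 1) by (rewrite <- Rinv_1; apply Rinv_le_contravar; lra).
  rewrite (Rabs_pos_eq (/ _)) by lra. nra. }
assert (Hex := ex_series_even_powers b (zeta 2) z 0 HB ltac:(apply Rabs_def1; lra)).
assert (E := weighted_series_eq p m z Hz).
rewrite weighted_form_eq in E by lra.
rewrite (Series_ext _ (fun n => z ^ (m + p + 2) * (b n * z ^ (2 * n + 0)))) in E.
2: { intros n; rewrite Hb. replace (2 * n + S (p + S m))%nat with ((m + p + 2) + (2 * n + 0))%nat by lia.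
     rewrite (pow_add z (m + p + 2)); ring. }
rewrite Series_scal_l in E. apply Rmult_eq_reg_l in E; [| apply pow_nonzero; lra].
rewrite <- E.
apply is_series_ext with (fun n => b n * z ^ (2 * n + 0)); [| now apply Series_correct].
intros n; unfold b; rewrite Nat.add_0_r. real_eq; unfold Rdiv; ring.
Qed.

Theorem mainTheorem8 (p m : nat) (z : R) (hz : 0 < Rabs z < 1) :
  is_series
    (fun n : nat =>
       zeta (2 * n) * z ^ (2 * n)
       / (consecutive_prod n m * INR (2 * n + m + p + 2)))
    (INR (p + m + 2)
     * ((-1) ^ (m + 1) * INR (fact p)
          * sum_n_m
              (fun k : nat =>
                 PI * z * (-1) ^ (k / 2) * Cl k (2 * PI * z)
                 / (INR (fact (p + m + 3 - k)) * (2 * PI * z) ^ k))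
              (m + 3) (p + m + 3)
        - kronecker (INR ((p + m) / 2)) (INR (p + m) / 2)
          * (INR (fact p) * (-1) ^ ((p + m) / 2) * (-1) ^ m * zeta (p + m + 3)
             / (2 * (2 * PI * z) ^ (m + p + 2))))
     + (-1) ^ ((m + 1) / 2) * Cl (m + 2) (2 * PI * z)
       / (2 * (2 * PI * z) ^ (m + 1))
     + sum_n_m
         (fun k : nat =>
            INR k * (-1) ^ k * zeta (2 * k + 1)
            / ((2 * PI * z) ^ (2 * k) * INR (fact (m + 1 - 2 * k))
               * INR (m + p + 2 - 2 * k)))
         1 ((m + 1) / 2)).
Proof.
fold (closed_form p m z).
destruct (Rlt_le_dec 0 z) as [Hpos | Hneg].
- apply is_series_closed_form. rewrite Rabs_pos_eq in hz; lra.
- rewrite Rabs_left1 in hz by trivial.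
  rewrite <- (Ropp_involutive z), closed_form_opp by lra.
  apply is_series_ext with (2 := is_series_closed_form p m (- z) hz).
  intros n. rewrite (pow_opp (- z)), pow_1_even, Rmult_1_l. reflexivity.
Qed.
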